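(* Let $\alpha\in(0,2)$, $\beta\in(-1,1)$, let $g\in C^1([0,1],\mathbb{R})$ with $g(0)=g(1)=0$, and let $u_0\in C(\mathbb{R},\mathbb{R})$ satisfy $0\le u_0(x)\le 1$ for all $x\in\mathbb{R}$, $\lim_{x\to\infty}u_0(x)=1$, and $\operatorname{supp}(u_0)\subset[0,\infty)$. Let $u$ be the (unique, global, $[0,1]$-valued) mild solution of $\partial_t u+Au=g(u)$ on $\mathbb{R}\times(0,\infty)$ with $u(\cdot,0)=u_0$, where $A=A_{\alpha,\beta}$. Assume that $g'(0)<0$. Then there exists $c>0$ such that $$\limsup_{t\to\infty}\ \sup_{x\le -ct}u(x,t)=0.$$
   Context: For $\alpha\in(0,2)$ and $\beta\in(-1,1)$ put $\rho=\alpha\beta$ if $\alpha<1$, $\rho=\beta$ if $\alpha=1$, $\rho=\beta(\alpha-2)$ if $\alpha>1$, and $p(\lambda)=e^{-i\frac{\pi}{2}\operatorname{sign}(\lambda)\rho}|\lambda|^\alpha$ for $\lambda\in\mathbb{R}$. $A=A_{\alpha,\beta}$ is the pseudo-differential operator on $\mathbb{R}$ with symbol $p$, with the Fourier transform convention $\hat w(\lambda)=\int_{\mathbb{R}}e^{i\lambda x}w(x)\,dx$ (i.e. $\widehat{Aw}=p\,\hat w$). Let $f_{\alpha\beta}$ be the (stable) probability density on $\mathbb{R}$ with characteristic function $\int_{\mathbb{R}}e^{i\lambda x}f_{\alpha\beta}(x)\,dx=e^{-p(\lambda)}$. Let $\mathcal{C}_{lim}$ be the Banach space of all $w\in C(\mathbb{R})$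 for which $\lim_{x\to\infty}w(x)$ and $\lim_{x\to-\infty}w(x)$ exist (finite), with the supremum norm. For $\varphi\in\mathcal{C}_{lim}$ let $S(0)\varphi=\varphi$ and, for $t>0$, $S(t)\varphi(x)=\int_{\mathbb{R}}t^{-1/\alpha}f_{\alpha\beta}\big(\tfrac{x-y}{t^{1/\alpha}}\big)\varphi(y)\,dy$; this is a positive $C_0$ semigroup on $\mathcal{C}_{lim}$, solving $\partial_t u+Au=0$. A mild solution of $\partial_t u+Au=g(u)$ with initial data $u_0\in\mathcal{C}_{lim}$ is a continuous curve $t\mapsto u(\cdot,t)\in\mathcal{C}_{lim}$ such that $u(\cdot,t)=S(t)u_0+\int_0^tS(t-s)\,g(u(\cdot,s))\,ds$ for all $t\ge0$. For $g$ and $u_0$ as in the claim there is a unique mild solution defined for all $t\ge 0$ with $0\le u(x,t)\le1$ for all $(x,t)$. *)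

(* Defs.v *)
From HB Require Import structures.
From mathcomp Require Import all_boot all_order all_algebra.
From mathcomp Require Import complex.
From mathcomp Require Import all_classical all_reals all_analysis.

Set Implicit Arguments.
Unset Strict Implicit.
Unset Printing Implicit Defensive.

Import Order.TTheory GRing.Theory Num.Theory.
Import numFieldNormedType.Exports.

Local Open Scope classical_set_scope.
Local Open Scope ring_scope.

Section complex_analysis.
Context {R : realType}.
Local Open Scope complex_scope.

Definition cexp (z : R[i]) : R[i] :=
  let: a +i* b := z in (expR a * cos b) +i* (expR a * sin b).

Definition Cintegral (h : R -> R[i]) : R[i] :=
  (\int[lebesgue_measure]_x complex.Re (h x)) +i* (\int[lebesgue_measure]_x complex.Im (h x)).

End complex_analysis.

Section stable.
Context {R : realType}.
Local Open Scope complex_scope.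

Definition skew (alpha beta : R) : R :=
  if alpha < 1 then alpha * beta
  else if alpha == 1 then beta
  else beta * (alpha - 2).

Definition symbol (alpha beta lambda : R) : R[i] :=
  cexp (- (0 +i* (pi / 2 * Num.sg lambda * skew alpha beta)))
    * (`|lambda| `^ alpha)%:C.

(* [f] is any version of the density: it is determined almost everywhere, and
   [semigroup] below only uses it under the integral sign. *)
Definition stable_density (alpha beta : R) (f : R -> R) : Prop :=
  [/\ measurable_fun [set: R] f,
      forall x, 0 <= f x,
      (\int[lebesgue_measure]_x (f x)%:E = 1)%E &
      forall lambda : R,
        Cintegral (fun x => cexp (0 +i* (lambda * x)) * (f x)%:C)
        = cexp (- symbol alpha beta lambda)].

End stable.

Section mild_solutions.
Context {R : realType}.

Definition C_lim (w : R -> R) : Prop :=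
  [/\ continuous w, cvg (w x @[x --> +oo]) & cvg (w x @[x --> -oo])].

Definition semigroup (f : R -> R) (alpha t : R) (phi : R -> R) : R -> R :=
  fun x =>
    if 0 < t then
      \int[lebesgue_measure]_y
        (t `^ (- alpha^-1) * f ((x - y) / t `^ (alpha^-1)) * phi y)
    else phi x.

(* Tagged partition [a = s 0 <= ... <= s n = b], tags [tau k] in
   [[s k, s k.+1]], with all steps smaller than [delta]. *)
Definition tagged_partition (a b delta : R) (n : nat) (s tau : nat -> R) : Prop :=
  [/\ s 0%N = a, s n = b &
      forall k, (k < n)%N ->
        s k <= tau k <= s k.+1 /\ s k.+1 - s k < delta].

(* [I] is the Riemann integral over [[a, b]] of the [C_lim]-valued map [F]:
   the Riemann sums converge to [I] in the supremum norm. *)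
Definition is_C_lim_integral (F : R -> R -> R) (a b : R) (I : R -> R) : Prop :=
  C_lim I /\
  forall eps : R, 0 < eps ->
    exists2 delta : R, 0 < delta &
      forall (n : nat) (s tau : nat -> R), tagged_partition a b delta n s tau ->
        forall x : R,
          `|\sum_(k < n) (s k.+1 - s k) * F (tau k) x - I x| <= eps.

(* The curve is [t |-> u t], so that [u t x] is the value at position [x] and
   time [t]; only times [t >= 0] matter. The uniform topology is that of the
   supremum norm. The operator [A] enters through its semigroup, hence through
   [alpha] and the density [f]. *)
Definition mild_solution (f : R -> R) (alpha : R) (g u0 : R -> R)
    (u : R -> R -> R) : Prop :=
  [/\ forall t : R, 0 <= t -> C_lim (u t),
      {within `[0, +oo[, continuous (u : R -> {uniform R -> R})} &
      forall t : R, 0 <= t ->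
        exists2 I : R -> R,
          is_C_lim_integral
            (fun s => semigroup f alpha (t - s) (g \o u s)) 0 t I &
          forall x, u t x = semigroup f alpha t u0 x + I x].

End mild_solutions.

Section C1_functions.
Context {R : realType}.

(* Derivative relative to [D], hence one-sided at the endpoints when [D] is an
   interval. *)
Definition quotient_at (D : set R) (g : R -> R) (x : R) : set_system R :=
  ((g y - g x) / (y - x)) @[y --> within D x^'].

Definition derive_on (D : set R) (g : R -> R) (x : R) : R :=
  lim (quotient_at D g x).

Definition C1_on (a b : R) (g : R -> R) : Prop :=
  (forall x, x \in `[a, b] -> cvg (quotient_at `[a, b] g x)) /\
  {within `[a, b], continuous (derive_on `[a, b] g)}.

End C1_functions.

(* Main.v *)
Require Import Defs.
From HB Require Import structures.
From mathcomp Require Import all_boot all_order all_algebra.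
From mathcomp Require Import complex ring lra.
From mathcomp Require Import all_classical all_reals all_analysis.
From mathcomp Require Import measurable_realfun.

Set Implicit Arguments.
Unset Strict Implicit.
Unset Printing Implicit Defensive.

Import Order.TTheory GRing.Theory Num.Theory.
Import numFieldNormedType.Exports.

Local Open Scope classical_set_scope.
Local Open Scope ring_scope.

(** The convolution semigroup acts by S(t) phi (x) = E phi (x - t^(1/alpha)
    V), where V has the stable density f.  Two consequences of the shape of
    the characteristic function of V carry the whole argument: the semigroup
    law S(t) S(s) = S(t+s) ([evolve_semigroup]), and the tail estimate
    P(t^(1/alpha) |V| >= D) <= C t / D^alpha ([evolve_tail]).  Both are read
    off the characteristic function by means of the Fejer kernel, a
    nonnegative integrable function which is itself an average of cosines.
    Integrated against the law of V, it gives the truncation inequality for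
    the tails.  Used as an approximate identity, it shows that the
    characteristic function determines the law ([charfun_unique]); strict
    stability then identifies a V + b V', with V' an independent copy of V,
    with c V whenever c^alpha = a^alpha + b^alpha.

    Fix a final time T and a point x, and follow y(s) = S(T-s) u(s) (x) from
    y(0) = S(T) u_0 (x) to y(T) = u(T, x).  The semigroup law turns the mild
    formulation into y' = S(T-s) g(u(s)) (x), in integrated form
    ([mild_increment]).  Since g'(0) < 0, there are gam, th > 0 with g(v) <= -
    gam v for v <= th.  If u(s) <= th to the left of b(s), then y' <= - gam y
    + M C (T-s) / (b(s) - x)^alpha for x < b(s), with M an upper bound for
    g(v) + gam v on [0, 1]: the linear term damps y, and the remainder only
    accounts for mass that jumps from the region where u is large
    ([reaction_bound]).  A scalar y with y' <= - gam y + N that starts in [0,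
    1] falls below any level above N / gam within a bounded time
    ([relaxation_bound]).

    The front is first confined: u <= th on x <= - c t - K ([front_confined]).
    This is shown by steps of a fixed length h with M h = th / 4.  The last
    stretch [T - h, T] raises y by at most th / 4, and before it the point x
    is at distance at least c h from the large region, so that the jump term
    is as small as desired once c is large.  The bound up to time T - h
    therefore gives the bound at time T.  At twice the speed the distance to
    the large region is of order c T and the jump term vanishes as T grows
    ([front_vanishing]). *)

(** * Bounded functions on probability spaces *)

Section bounded_integrals.
Context d (T : measurableType d) (R : realType) (P : probability T R).
Implicit Types h : T -> R.

Lemma bounded_integrable h M : measurable_fun setT h ->
  (forall x, `|h x| <= M) -> P.-integrable setT (EFin \o h).
Proof.
move=> mh hM; apply: (@le_integrable _ _ _ P setT _ _ (EFin \o cst M)) => //.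
- exact/measurable_EFinP.
- by move=> x _ /=; rewrite lee_fin (le_trans (hM x))// ler_norm.
- exact: finite_measure_integrable_cst.
Qed.

Lemma le_bounded_Rintegral h1 h2 M : measurable_fun setT h1 ->
  measurable_fun setT h2 -> (forall x, `|h1 x| <= M) ->
  (forall x, `|h2 x| <= M) -> (forall x, h1 x <= h2 x) ->
  \int[P]_x h1 x <= \int[P]_x h2 x.
Proof.
by move=> m1 m2 b1 b2 h12; apply: le_Rintegral => //;
  [exact: bounded_integrable m1 b1|exact: bounded_integrable m2 b2].
Qed.

Lemma Rintegral_prob_cst (r : R) : \int[P]_x r = r.
Proof.
rewrite Rintegral_cst//= -[RHS]mulr1; congr (_ * _).
by have /= -> := @probability_setT _ _ _ P.
Qed.

Lemma norm_bounded_Rintegral h M : measurable_fun setT h ->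
  (forall x, `|h x| <= M) -> `|\int[P]_x h x| <= M.
Proof.
move=> mh hM; apply: le_trans (le_normr_Rintegral _ (bounded_integrable mh hM)) _ => //.
rewrite -[leRHS]Rintegral_prob_cst; apply: (@le_bounded_Rintegral _ _ M) => //.
- exact: measurableT_comp.
- by move=> x; rewrite normr_id.
- by move=> x; rewrite ger0_norm// (le_trans _ (hM x)).
Qed.

End bounded_integrals.

Section bounded_fubini.
Context d1 d2 (T1 : measurableType d1) (T2 : measurableType d2) (R : realType).
Context (P1 : probability T1 R) (P2 : probability T2 R).
Variables (h : T1 * T2 -> R) (M : R).
Hypotheses (mh : measurable_fun setT h) (hM : forall z, `|h z| <= M).

Let ih : (P1 \x P2)%E.-integrable setT (EFin \o h).
Proof. exact: (@bounded_integrable _ _ _ (P1 \x P2)%E _ _ mh hM). Qed.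

Let mh1 x : measurable_fun setT (fun y => h (x, y)).
Proof. exact: measurableT_comp mh (measurable_pair1 x). Qed.

Let mh2 y : measurable_fun setT (fun x => h (x, y)).
Proof. exact: measurableT_comp mh (measurable_pair2 y). Qed.

Lemma measurable_Rintegral2 : measurable_fun setT (fun x => \int[P2]_y h (x, y)).
Proof. exact: measurableT_comp (@fine_measurable _ _ measurableT) (measurable_fubini_F ih). Qed.

Lemma bounded_Rintegral_prod :
  \int[(P1 \x P2)%E]_z h z = \int[P1]_x \int[P2]_y h (x, y).
Proof.
rewrite /Rintegral; congr fine.
rewrite -[LHS](integral12_prod_meas1 ih); apply: eq_integral => x _.
rewrite fineK//; apply: integrable_fin_num => //.
exact: bounded_integrable (mh1 x) (fun y => hM (x, y)).
Qed.

Lemma bounded_Fubini :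
  \int[P1]_x \int[P2]_y h (x, y) = \int[P2]_y \int[P1]_x h (x, y).
Proof.
have := Fubini ih; rewrite /Rintegral => F; congr fine.
transitivity (\int[P1]_x \int[P2]_y (EFin \o h) (x, y))%E.
  apply: eq_integral => x _; rewrite fineK//; apply: integrable_fin_num => //.
  exact: bounded_integrable (mh1 x) (fun y => hM (x, y)).
rewrite F; apply: eq_integral => y _; rewrite fineK//.
apply: integrable_fin_num => //.
exact: bounded_integrable (mh2 y) (fun x => hM (x, y)).
Qed.

End bounded_fubini.

(** * Probability laws given by a density *)

Section density.
Context (R : realType).
Local Notation mu := (@lebesgue_measure R).
Variable f : measurableTypeR R -> R.
Hypotheses (mf : measurable_fun setT f) (f0 : forall x, 0 <= f x)
  (f1 : (\int[mu]_x (f x)%:E = 1)%E).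

Import HBNNSimple.

(** The law is obtained as an abstract probability, so that all later
    integrals against it are expectations to which Fubini and dominated
    convergence for finite measures apply. *)
Lemma density_probability : exists P : probability (measurableTypeR R) R,
  forall A, measurable A -> P A = (\int[mu]_(x in A) (f x)%:E)%E.
Proof.
pose Q (A : set (measurableTypeR R)) := (\int[mu]_(x in A) (f x)%:E)%E.
have Q0 : Q set0 = 0%E by rewrite /Q integral_set0.
have Q_ge0 A : (0 <= Q A)%E by apply: integral_ge0 => x _; rewrite lee_fin.
have Qadd : semi_sigma_additive Q.
  move=> F mF tF mUF; rewrite /Q; apply: cvg_toP.
    apply: ereal_nondecreasing_is_cvgn => m n mn.
    apply: lee_sum_nneg_natr => // k _ _.
    by apply: integral_ge0 => /= x Fkx; rewrite lee_fin.
  rewrite ge0_integral_bigcup//=.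
  - by apply: measurable_funTS; exact/measurable_EFinP.
  - by move=> x _; rewrite lee_fin.
pose M : {measure set (measurableTypeR R) -> \bar R} :=
  HB.pack Q (isMeasure.Build _ _ _ Q Q0 Q_ge0 Qadd).
have M1 : M setT = 1%E by [].
pose P : probability (measurableTypeR R) R :=
  HB.pack Q (isMeasure.Build _ _ _ Q Q0 Q_ge0 Qadd)
    (Measure_isProbability.Build _ _ _ M M1).
by exists P.
Qed.

Lemma ge0_integral_density (P : probability (measurableTypeR R) R)
    (h : measurableTypeR R -> \bar R) :
  (forall A, measurable A -> P A = (\int[mu]_(x in A) (f x)%:E)%E) ->
  measurable_fun setT h -> (forall x, 0 <= h x)%E ->
  (\int[P]_x h x = \int[mu]_x ((f x)%:E * h x))%E.
Proof.
move=> PE mh h0; pose h_ := nnsfun_approx measurableT mh.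
have mef : measurable_fun setT (fun x => (f x)%:E) by exact/measurable_EFinP.
have ef0 x : (0 <= (f x)%:E)%E by rewrite lee_fin.
have hE x : h x = limn (fun n => (h_ n x)%:E).
  by apply/esym/cvg_lim => //; exact: cvg_nnsfun_approx.
transitivity (limn (fun n => \int[P]_x (h_ n x)%:E))%E.
  rewrite -monotone_convergence//=.
  - by apply: eq_integral => x _; exact: hE.
  - by move=> n; exact/measurable_EFinP/measurable_funTS.
  - by move=> n x _; rewrite lee_fin.
  - by move=> x _ m n mn; rewrite lee_fin; exact/lefP/nd_nnsfun_approx.
transitivity (limn (fun n => \int[mu]_x ((f x)%:E * (h_ n x)%:E)))%E; last first.
  rewrite -monotone_convergence//=.
  - apply: eq_integral => x _; apply/cvg_lim => //; apply: cvgeZl => //.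
    exact: cvg_nnsfun_approx.
  - by move=> n; apply: emeasurable_funM => //; exact/measurable_EFinP/measurable_funTS.
  - by move=> n x _; rewrite mule_ge0// lee_fin.
  - move=> x _ m n mn; rewrite lee_wpmul2l// lee_fin.
    exact/lefP/nd_nnsfun_approx.
apply: congr_lim; apply/funext => n.
under [LHS]eq_integral do rewrite fimfunE -fsumEFin//.
rewrite ge0_integral_fsum//; last 2 first.
- by move=> r; exact/measurable_EFinP/measurableT_comp.
- by move=> r x _; rewrite EFinM nnfun_muleindic_ge0.
under [RHS]eq_integral.
  move=> x _; rewrite fimfunE -fsumEFin// ge0_mule_fsumr; last first.
    by move=> r; rewrite EFinM nnfun_muleindic_ge0.
  over.
rewrite ge0_integral_fsum//; last 2 first.
- by move=> r; apply: emeasurable_funM => //; exact/measurable_EFinP/measurableT_comp.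
- by move=> r x _; rewrite mule_ge0// EFinM nnfun_muleindic_ge0.
apply: eq_fsbigr => r rhn.
have r0 : 0 <= r by move: rhn; rewrite inE => -[t _ <-].
under eq_integral do rewrite EFinM.
rewrite integralZl_indic_nnsfun// integral_indic//= setIT PE//.
under [RHS]eq_integral do rewrite EFinM muleCA.
rewrite ge0_integralZl//; last 2 first.
- by apply: emeasurable_funM => //; exact/measurable_EFinP.
- by move=> x _; rewrite mule_ge0// lee_fin.
congr (_ * _)%E.
by rewrite [LHS]integral_mkcond; apply: eq_integral => x _; rewrite epatch_indic.
Qed.

Lemma Rintegral_density (P : probability (measurableTypeR R) R) (h : measurableTypeR R -> R) :
  (forall A, measurable A -> P A = (\int[mu]_(x in A) (f x)%:E)%E) ->
  measurable_fun setT h -> \int[P]_x h x = \int[mu]_x (f x * h x).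
Proof.
move=> PE mh; rewrite /Rintegral; congr fine.
have fE x : (f x * h x)%:E = ((f x)%:E * (h x)%:E)%E by [].
rewrite [LHS]integralE [RHS]integralE; congr (_ - _)%E.
- rewrite ge0_integral_density//; last exact/measurable_funepos/measurable_EFinP.
  apply: eq_integral => x _; rewrite !funeposE fE.
  by rewrite maxeMr ?lee_fin// mule0.
- rewrite ge0_integral_density//; last exact/measurable_funeneg/measurable_EFinP.
  apply: eq_integral => x _; rewrite !funenegE fE -muleN.
  by rewrite maxeMr ?lee_fin// mule0.
Qed.

End density.

(** * Affine substitution in Lebesgue integrals *)

Section affine_substitution.
Context (R : realType).
Local Notation mu := (@lebesgue_measure R).

(** Lebesgue measure is determined by its values on half-open intervals, and an
    affine map of slope b scales those by b; this reaches integrands that are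
    merely measurable, such as the stable density. *)
Lemma ge0_integral_affine (a b : R) (h : measurableTypeR R -> \bar R) : 0 < b ->
  measurable_fun setT h -> (forall x, 0 <= h x)%E ->
  (\int[mu]_y h y = b%:E * \int[mu]_z h (a + b * z)%R)%E.
Proof.
move=> b0 mh h0; pose phi (z : measurableTypeR R) : measurableTypeR R := a + b * z.
have mphi : measurable_fun setT phi.
  by apply: measurable_funD => //; apply: measurable_funM.
pose mphi_mixin := isMeasurableFun.Build _ _ _ _ _ mphi.
pose Phi : {mfun measurableTypeR R >-> measurableTypeR R} := HB.pack phi mphi_mixin.
have muE A : measurable A -> mu A = mscale (NngNum (ltW b0)) (pushforward mu Phi) A.
  apply: lebesgue_measure_unique => _ [[p q]] _ <-.
  rewrite -[RHS]/(b%:E * mu (phi @^-1` `]p, q]%classic))%E.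
  have -> : phi @^-1` `]p, q]%classic = `](p - a) / b, (q - a) / b]%classic.
    apply/seteqP; split=> z /=; rewrite /= !in_itv/= /phi ltr_pdivrMr// ler_pdivlMr//;
      by rewrite ltrBlDl lerBrDl (mulrC b).
  rewrite !lebesgue_measure_itv/= !lte_fin ltr_pM2r ?invr_gt0// ltrD2r.
  case: ifPn => pq; last by rewrite mule0.
  rewrite !EFinN -!EFinD -EFinM; congr EFin; field.
  by rewrite gt_eqF.
rewrite (eq_measure_integral (mscale (NngNum (ltW b0)) (pushforward mu Phi))); last first.
  by move=> A mA _; exact: muE.
rewrite ge0_integral_mscale//; congr (_ * _)%E.
by rewrite ge0_integral_pushforward.
Qed.

Lemma ge0_integral_reflect (h : measurableTypeR R -> \bar R) :
  measurable_fun setT h -> (forall x, 0 <= h x)%E ->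
  (\int[mu]_z h (- z)%R = \int[mu]_z h z)%E.
Proof.
move=> mh h0.
rewrite [RHS](eq_measure_integral
    (pushforward mu (-%R : _ -> measurableTypeR R))); last first.
  by move=> A mA _; exact/esym/lebesgue_measureN.
by rewrite ge0_integral_pushforward.
Qed.

Lemma ge0_integral_convolution (x b : R) (h : measurableTypeR R -> \bar R) :
  0 < b -> measurable_fun setT h -> (forall x, 0 <= h x)%E ->
  (\int[mu]_y h ((x - y) / b)%R = b%:E * \int[mu]_v h v)%E.
Proof.
move=> b0 mh h0; rewrite (@ge0_integral_affine x b)//; last first.
  apply: measurableT_comp mh _; apply: measurable_funM => //.
  exact: measurable_funB.
rewrite -[in RHS]ge0_integral_reflect//; congr (_ * _)%E; apply: eq_integral => z _.
by congr (h _); field; rewrite gt_eqF.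
Qed.

(** The substitution y = x - b v, which turns convolution with a rescaled
    density into an expectation. *)
Lemma Rintegral_convolution (x b : R) (h : measurableTypeR R -> R) :
  0 < b -> measurable_fun setT h ->
  \int[mu]_y (b^-1 * h ((x - y) / b)) = \int[mu]_v h v.
Proof.
move=> b0 mh; rewrite /Rintegral; congr fine.
have ge0 (k : measurableTypeR R -> \bar R) : measurable_fun setT k ->
    (forall x, 0 <= k x)%E ->
    (\int[mu]_y (b^-1%:E * k ((x - y) / b)%R) = \int[mu]_v k v)%E.
  move=> mk k0; rewrite ge0_integralZl//.
  - rewrite ge0_integral_convolution// muleA -EFinM mulVf ?mul1e//.
    by rewrite gt_eqF.
  - apply: measurableT_comp mk _; apply: measurable_funM => //.
    exact: measurable_funB.
  - by rewrite lee_fin invr_ge0 ltW.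
rewrite [LHS]integralE [RHS]integralE; congr (_ - _)%E.
- rewrite -[in RHS]ge0//; last exact/measurable_funepos/measurable_EFinP.
  apply: eq_integral => y _; rewrite !funeposE EFinM.
  by rewrite maxeMr ?mule0// lee_fin invr_ge0 ltW.
- rewrite -[in RHS]ge0//; last exact/measurable_funeneg/measurable_EFinP.
  apply: eq_integral => y _; rewrite !funenegE EFinM -muleN.
  by rewrite maxeMr ?mule0// lee_fin invr_ge0 ltW.
Qed.

End affine_substitution.

(** * The Fejer kernel *)

Section fejer.
Context (R : realType).
Local Notation mu := (@lebesgue_measure R).

Lemma everywhere_FTC2 (F f : R -> R) (a b : R) : a < b -> continuous f ->
  (forall x : R, is_derive x 1 F (f x)) ->
  (\int[mu]_(x in `[a, b]) (f x)%:E = (F b - F a)%:E)%E.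
Proof.
move=> ab cf Ff.
have cF : continuous F by move=> x; apply/differentiable_continuous/derivable1_diffP.
rewrite (@continuous_FTC2 _ f F)//.
- exact: continuous_subspaceT.
- split; first by move=> x _; apply: ex_derive.
  + exact/cvg_at_right_filter/cF.
  + exact/cvg_at_left_filter/cF.
- by move=> x _; rewrite derive1E; exact: derive_val.
Qed.

(** The probability density on [0, 1] whose cosine transform
    2 (1 - cos y) / y^2 is the Fejer kernel.  One half of the triangle density
    suffices because only cosines are averaged. *)
Definition half_triangle (l : R) : R := (2 * (1 - l)) * \1_(`[0, 1] : set R) l.

Lemma measurable_half_triangle : measurable_fun setT half_triangle.
Proof.
apply: measurable_funM; last exact: measurable_indic.
by apply: measurable_funM => //; apply: measurable_funB.
Qed.

Lemma half_triangle_ge0 l : 0 <= half_triangle l.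
Proof.
rewrite /half_triangle indicE; case: (boolP (l \in _)); last by rewrite mulr0.
by rewrite inE /= in_itv/= mulr1 => /andP[? ?]; lra.
Qed.

Lemma Rintegral_half_triangle (h : R -> R) :
  \int[mu]_l (half_triangle l * h l) = \int[mu]_(l in `[0, 1]) (2 * (1 - l) * h l).
Proof.
rewrite [RHS]Rintegral_mkcond; apply: eq_Rintegral => l _.
rewrite /half_triangle patchE indicE; case: ifPn => _; first by rewrite mulr1.
by rewrite mulr0 mul0r.
Qed.

Lemma integral_half_triangle : (\int[mu]_l (half_triangle l)%:E = 1)%E.
Proof.
transitivity (\int[mu]_(l in `[0%R, 1%R]) (2 * (1 - l))%:E)%E.
  rewrite [RHS]integral_mkcond; apply: eq_integral => l _.
  rewrite /half_triangle patchE indicE; case: ifPn => _; first by rewrite mulr1.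
  by rewrite mulr0.
have cf : continuous (fun l : R => 2 * (1 - l)).
  move=> x; apply: cvgM; first exact: cvg_cst.
  by apply: cvgB; [exact: cvg_cst|exact: cvg_id].
have dF (l : R) : is_derive l 1 (fun l : R => 2 * l - l ^+ 2) (2 * (1 - l)).
  apply: is_derive_eq; rewrite /GRing.scale/=. ring.
by rewrite (everywhere_FTC2 ltr01 cf dF); congr EFin; ring.
Qed.

(** Integration by parts, written through the antiderivative
    2 (1 - l) sin(l y) / y - 2 cos(l y) / y^2. *)
Lemma Rintegral_half_triangle_cos y : y != 0 ->
  \int[mu]_(l in `[0, 1]) (2 * (1 - l) * cos (l * y)) = 2 * (1 - cos y) / y ^+ 2.
Proof.
move=> y0; rewrite /Rintegral.
have cf : continuous (fun l : R => 2 * (1 - l) * cos (l * y)).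
  move=> x; apply: cvgM.
    apply: cvgM; first exact: cvg_cst.
    by apply: cvgB; [exact: cvg_cst|exact: cvg_id].
  apply: (@cvg_comp _ _ _ (fun x => x * y) cos); last exact: continuous_cos.
  by apply: cvgM; [exact: cvg_id|exact: cvg_cst].
have dF (l : R) : is_derive l 1
    (fun l => 2 * (1 - l) * (sin (l * y) / y) - 2 * cos (l * y) / y ^+ 2)
    (2 * (1 - l) * cos (l * y)).
  apply: is_derive_eq; rewrite /GRing.scale/=. by field.
rewrite (everywhere_FTC2 ltr01 cf dF)/= !mul1r !mul0r cos0 sin0; field.
by [].
Qed.

End fejer.

Section fejer_law.
Context (R : realType).

Lemma fejer_law_exists : exists L : probability (measurableTypeR R) R,
  (forall y, y != 0 -> \int[L]_l cos (l * y) = 2 * (1 - cos y) / y ^+ 2) /\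
  (forall h1 h2 : R -> R, measurable_fun setT h1 -> measurable_fun setT h2 ->
     {in `[0, 1], h1 =1 h2} -> \int[L]_l h1 l = \int[L]_l h2 l).
Proof.
have mt := @measurable_half_triangle R.
have [L LE] := density_probability mt (@half_triangle_ge0 R) (integral_half_triangle R).
exists L; split=> [y y0|h1 h2 m1 m2 h12].
  rewrite (Rintegral_density mt (@half_triangle_ge0 R) LE); last first.
    apply: measurableT_comp; first exact: continuous_measurable_fun (@continuous_cos R).
    exact: measurable_funM.
  by rewrite Rintegral_half_triangle Rintegral_half_triangle_cos.
rewrite !(Rintegral_density mt (@half_triangle_ge0 R) LE)//.
rewrite !Rintegral_half_triangle; apply: eq_Rintegral => l.
by rewrite inE/= => /h12 ->.
Qed.

Definition fejer_law := sval (cid fejer_law_exists).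

(** The law is carried by [0, 1], so that bounds valid only for frequencies in
    [0, 1] can be used under the integral. *)
Lemma fejer_law_support (h1 h2 : R -> R) : measurable_fun setT h1 ->
  measurable_fun setT h2 -> {in `[0, 1], h1 =1 h2} ->
  \int[fejer_law]_l h1 l = \int[fejer_law]_l h2 l.
Proof. by rewrite /fejer_law; case: cid => L [_ +] /=; exact. Qed.

Lemma measurable_cosM : measurable_fun setT
  (fun z : measurableTypeR R * measurableTypeR R => cos (z.2 * z.1)).
Proof.
apply: measurableT_comp; first exact: continuous_measurable_fun (@continuous_cos R).
by apply: measurable_funM.
Qed.

(** The Fejer kernel as an average of cosines.  This form makes the expectation
    of the kernel at a random variable a function of the characteristic
    function alone; [fejerE] is the closed form that shows its sign and its
    decay. *)
Definition fejer (y : R) := \int[fejer_law]_l cos (l * y).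

Lemma measurable_fejer : measurable_fun setT (fejer : measurableTypeR R -> R).
Proof.
exact: (measurable_Rintegral2 fejer_law fejer_law measurable_cosM
  (fun z => cos_max (z.2 * z.1))).
Qed.

Lemma fejerE y : y != 0 -> fejer y = 2 * (1 - cos y) / y ^+ 2.
Proof. by rewrite /fejer /fejer_law; case: cid => L [+ _] /=; exact. Qed.

Lemma fejer0 : fejer 0 = 1.
Proof.
rewrite /fejer; under eq_Rintegral do rewrite mulr0 cos0.
exact: Rintegral_prob_cst.
Qed.

Lemma fejer_ge0 y : 0 <= fejer y.
Proof.
have [->|y0] := eqVneq y 0; first by rewrite fejer0.
by rewrite fejerE// divr_ge0 ?sqr_ge0// mulr_ge0// subr_ge0 cos_le1.
Qed.

Let measurable_cosy y : measurable_fun setT (fun l : measurableTypeR R => cos (l * y)).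
Proof.
apply: measurableT_comp; first exact: continuous_measurable_fun (@continuous_cos R).
exact: measurable_funM.
Qed.

Lemma fejer_le1 y : fejer y <= 1.
Proof.
apply: le_trans (ler_norm _) _; apply: norm_bounded_Rintegral => //.
by move=> l; exact: cos_max.
Qed.

Lemma fejer_mul_sqr y : fejer y * y ^+ 2 <= 4.
Proof.
have [->|y0] := eqVneq y 0; first by rewrite expr0n mulr0.
rewrite fejerE// divfK ?sqrf_eq0//.
by have := cos_geN1 y; lra.
Qed.

(** Integrability of the kernel by comparison with the Cauchy density, whose
    mass is the known limit of the arctangent. *)
Lemma fejer_le_cauchy y : fejer y <= 5 * (oneDsqr y)^-1.
Proof.
rewrite ler_pdivlMr; last by rewrite (lt_le_trans ltr01) ?oneDsqr_ge1.
by rewrite /oneDsqr mulrDr; have := fejer_mul_sqr y; have := fejer_le1 y; lra.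
Qed.

(** All the angles l y lie in [0, 1], where the cosine is at least cos 1 > 0;
    this is what keeps the total mass of the kernel away from zero. *)
Lemma fejer_ge y : 0 <= y <= 1 -> cos 1 <= fejer y.
Proof.
move=> /andP[y0 y1].
rewrite /fejer (fejer_law_support (h2 := fun l => Num.max (cos 1) (cos (l * y)))).
- rewrite -[leLHS](Rintegral_prob_cst fejer_law).
  apply: (@le_bounded_Rintegral _ _ _ _ _ _ 1) => //.
  + by apply: measurable_maxr => //; exact: measurable_cosy.
  + by move=> l; exact: cos_max.
  + by move=> l; rewrite /Num.max; case: ifP => _; exact: cos_max.
  + by move=> l; rewrite le_max lexx.
- exact: measurable_cosy.
- by apply: measurable_maxr => //; exact: measurable_cosy.
- move=> l; rewrite in_itv/= => /andP[l0 l1]; apply/esym/max_idPr.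
  have ly0 : 0 <= l * y by exact: mulr_ge0.
  have ly1 : l * y <= 1 by rewrite mulr_ile1.
  have pi1 : 1 <= pi :> R by rewrite (le_trans _ (pi_ge2 R))// ler1n.
  rewrite le_eqVlt; have [->|ne] := eqVneq (l * y) 1; first by rewrite eqxx.
  have i1 : (1 : R) \in `[0, pi] by rewrite in_itv/= ler01.
  have i2 : l * y \in `[0, pi] by rewrite in_itv/= ly0 (le_trans ly1).
  by apply/orP; right; rewrite ltr_cos// lt_neqAle ne.
Qed.

Local Notation mu := (@lebesgue_measure R).

Definition fejer_mass := (\int[mu]_y (fejer y)%:E)%E.

Lemma integrable_fejer : mu.-integrable setT (fun y => (fejer y)%:E).
Proof.
apply: (@le_integrable _ _ _ mu setT _ _ (fun y => (5 * (oneDsqr y)^-1)%:E)) => //.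
- apply/measurable_EFinP; exact: measurable_fejer.
- move=> y _ /=; rewrite lee_fin ger0_norm ?fejer_ge0//.
  by rewrite (le_trans (fejer_le_cauchy y))// ler_norm.
have cD := @continuous_oneDsqrV R.
have D0 (y : R) : 0 <= (oneDsqr y)^-1.
  by rewrite invr_ge0 (le_trans ler01)// oneDsqr_ge1.
have -> : (fun y : R => (5 * (oneDsqr y)^-1)%:E) = (fun y => 5%:E * (oneDsqr y)^-1%:E)%E.
  by apply/funext.
apply: integrableZl => //; apply/integrableP; split.
  by apply/measurable_EFinP; exact: (continuous_measurable_fun cD).
under eq_integral do rewrite gee0_abs ?lee_fin//.
rewrite ge0_symfun_integralT//.
  by rewrite -set_itvcy integral0y_oneDsqr -EFinM ltry.
by move=> y; rewrite /= /oneDsqr sqrrN.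
Qed.

Lemma fejer_mass_fin : fejer_mass \is a fin_num.
Proof. exact: integrable_fin_num integrable_fejer. Qed.

Lemma fejer_mass_gt0 : (0 < fejer_mass)%E.
Proof.
apply: (@lt_le_trans _ _ (\int[mu]_(y in `[0%R, 1%R]) (cos 1)%:E)%E).
  rewrite integral_cst//= lebesgue_measure_itv/= lte_fin ltr01 oppr0 adde0 mule1.
  by rewrite lte_fin cos1_gt0.
apply: (@le_trans _ _ (\int[mu]_(y in `[0%R, 1%R]) (fejer y)%:E)%E).
  apply: ge0_le_integral => //=.
  - by move=> y _; rewrite lee_fin ltW// cos1_gt0.
  - by apply/measurable_funTS/measurable_EFinP; exact: measurable_fejer.
  - by move=> y; rewrite in_itv/= lee_fin; exact: fejer_ge.
apply: ge0_subset_integral => //.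
- by apply/measurable_EFinP; exact: measurable_fejer.
- by move=> y _; rewrite lee_fin fejer_ge0.
Qed.

End fejer_law.

(** * Characteristic functions determine the law *)

Section charfun_fejer.
Context d (T : measurableType d) (R : realType) (P : probability T R).
Variable X : T -> measurableTypeR R.
Hypothesis mX : measurable_fun setT X.

Lemma measurable_cosX l : measurable_fun setT (fun w => cos (l * X w)).
Proof.
apply: measurableT_comp; first exact: continuous_measurable_fun (@continuous_cos R).
exact: measurable_funM.
Qed.

Lemma measurable_sinX l : measurable_fun setT (fun w => sin (l * X w)).
Proof.
apply: measurableT_comp; first exact: continuous_measurable_fun (@continuous_sin R).
exact: measurable_funM.
Qed.

(** Exchange of the two averages: the expectation of the kernel at a random
    variable only involves its characteristic function, whose real and
    imaginary parts are the expectations of cos and sin. *)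
Lemma integral_fejer_charfun (y k : R) :
  \int[P]_w fejer ((y - X w) * k) =
  \int[fejer_law R]_l (cos (l * k * y) * \int[P]_w cos (l * k * X w) +
                       sin (l * k * y) * \int[P]_w sin (l * k * X w)).
Proof.
pose h (z : T * measurableTypeR R) : R := cos (z.2 * ((y - X z.1) * k)).
have mh : measurable_fun setT h.
  apply: measurableT_comp; first exact: continuous_measurable_fun (@continuous_cos R).
  apply: measurable_funM => //; apply: measurable_funM => //.
  by apply: measurable_funB => //; exact: measurableT_comp.
rewrite /fejer (bounded_Fubini P (fejer_law R) mh (fun z => cos_max _)).
apply: eq_Rintegral => l _; rewrite /h /=.
have ic := bounded_integrable P (measurable_cosX (l * k)) (fun w => cos_max _).
have isn := bounded_integrable P (measurable_sinX (l * k)) (fun w => sin_max _).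
rewrite -!RintegralZl// -RintegralD//; last 2 first.
- exact: (integrableZl _ _ ic).
- exact: (integrableZl _ _ isn).
apply: eq_Rintegral => w _; rewrite -cosB; congr cos; ring.
Qed.

End charfun_fejer.

Section mollification.
Context (R : realType).
Local Notation mu := (@lebesgue_measure R).
Variables (phi : R -> R) (M : R).
Hypotheses (cphi : continuous phi) (phi0 : forall x, 0 <= phi x)
  (phiM : forall x, phi x <= M).

Let mphi : measurable_fun setT (phi : measurableTypeR R -> R).
Proof. exact: continuous_measurable_fun. Qed.

Let mphi_affine (a b : R) :
  measurable_fun setT (fun z : measurableTypeR R => phi (a + b * z)).
Proof.
by apply: measurableT_comp mphi _; apply: measurable_funD.
Qed.

(** Convolution of phi with the kernel at scale 1 / (n + 1), up to the constant
    factor [fejer_mass], which is positive and cancels at the end. *)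
Definition mollified (n : nat) (x : R) : \bar R :=
  (\int[mu]_z (phi (x + n.+1%:R^-1 * z) * fejer z)%:E)%E.

Lemma mollified_ge0 n x : (0 <= mollified n x)%E.
Proof.
by apply: integral_ge0 => z _; rewrite lee_fin mulr_ge0 ?fejer_ge0.
Qed.

Lemma mollified_le n x : (mollified n x <= M%:E * fejer_mass R)%E.
Proof.
have mf : measurable_fun setT (@fejer R : measurableTypeR R -> R).
  exact: measurable_fejer.
have fE0 (z : measurableTypeR R) : setT z -> (0 <= (fejer z)%:E)%E.
  by rewrite lee_fin fejer_ge0.
have M0 : (0 <= M%:E)%E by rewrite lee_fin (le_trans (phi0 0)).
have mfE : measurable_fun setT (fun z : measurableTypeR R => (fejer z)%:E).
  exact/measurable_EFinP.
rewrite /fejer_mass -ge0_integralZl//=.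
apply: ge0_le_integral => //=.
- by move=> z _; rewrite lee_fin mulr_ge0 ?fejer_ge0.
- by apply/measurable_EFinP; apply: measurable_funM.
- exact: measurable_funeM.
- by move=> z _; rewrite lee_fin ler_wpM2r ?fejer_ge0.
Qed.

Lemma cvg_mollified x :
  mollified ^~ x @ \oo --> ((phi x)%:E * fejer_mass R)%E.
Proof.
have mf : measurable_fun setT (@fejer R : measurableTypeR R -> R) by exact: measurable_fejer.
have -> : ((phi x)%:E * fejer_mass R = \int[mu]_z (phi x * fejer z)%:E)%E.
  rewrite /fejer_mass -ge0_integralZl//=.
  - by apply/measurable_EFinP.
  - by move=> z _; rewrite lee_fin fejer_ge0.
  - by rewrite lee_fin.
have [] := @dominated_convergence _ (measurableTypeR R) R mu setT measurableT
  (fun n z => (phi (x + n.+1%:R^-1 * z) * fejer z)%:E)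
  (fun z => (phi x * fejer z)%:E) (fun z => (M * fejer z)%:E) _ _ _ _ _ => //.
- by move=> n; apply/measurable_EFinP; apply: measurable_funM.
- by apply/measurable_EFinP; apply: measurable_funM.
- apply/aeW => z _; apply/cvg_EFin; first exact: nearW.
  have cx : (x + n.+1%:R^-1 * z) @[n --> \oo] --> x.
    rewrite -[X in _ --> X]addr0 -[X in _ + X](mul0r z).
    apply: cvgD; first exact: cvg_cst.
    by apply: cvgM; [exact: cvg_harmonic|exact: cvg_cst].
  have cpx : phi (x + n.+1%:R^-1 * z) @[n --> \oo] --> phi x.
    exact: (@cvg_comp _ _ _ _ phi _ _ _ cx (@cphi x)).
  exact: (cvgM cpx (cvg_cst (fejer z))).
- have -> : (fun z => (M * fejer z)%:E) = (fun z => M%:E * (fejer z)%:E)%E by apply/funext.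
  by apply: integrableZl => //; exact: integrable_fejer.
- apply/aeW => z n _ /=; rewrite lee_fin ger0_norm ?mulr_ge0 ?fejer_ge0//.
  by rewrite ler_wpM2r ?fejer_ge0.
Qed.

(** The kernel carries the dependence on x in this form, so that averaging over
    a random x brings in the characteristic function only. *)
Lemma mollifiedE n x : mollified n x =
  (n.+1%:R%:E * \int[mu]_y (phi y * fejer ((y - x) * n.+1%:R))%:E)%E.
Proof.
pose h (y : measurableTypeR R) := (phi y * fejer ((y - x) * n.+1%:R))%:E.
have n0 : 0 < n.+1%:R^-1 :> R by rewrite invr_gt0 ltr0n.
have mh : measurable_fun setT h.
  apply/measurable_EFinP; apply: measurable_funM => //.
  apply: measurableT_comp; first exact: measurable_fejer.
  by apply: measurable_funM => //; exact: measurable_funB.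
rewrite -/(h _) (@ge0_integral_affine _ x n.+1%:R^-1 h)//; last first.
  by move=> y; rewrite lee_fin mulr_ge0 ?fejer_ge0.
have n1 : n.+1%:R / n.+1%:R = 1 :> R by rewrite divff// pnatr_eq0.
rewrite muleA -EFinM n1 mul1e; apply: eq_integral => z _.
rewrite /h; congr (_ * fejer _)%:E.
by rewrite addrC addKr mulrAC mulVf ?mul1r// pnatr_eq0.
Qed.

Section law.
Context d (T : measurableType d) (P : probability T R).
Variable X : T -> measurableTypeR R.
Hypothesis mX : measurable_fun setT X.

Let mker n : measurable_fun setT (fun z : T * measurableTypeR R =>
  (phi z.2 * fejer ((z.2 - X z.1) * n.+1%:R))%:E).
Proof.
apply/measurable_EFinP; apply: measurable_funM; first exact: measurableT_comp mphi _.
apply: measurableT_comp; first exact: measurable_fejer.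
apply: measurable_funM => //; apply: measurable_funB => //.
exact: measurableT_comp.
Qed.

Let ker_ge0 n (z : T * measurableTypeR R) :
  (0 <= (phi z.2 * fejer ((z.2 - X z.1) * n.+1%:R))%:E)%E.
Proof. by rewrite lee_fin mulr_ge0 ?fejer_ge0. Qed.

Lemma measurable_mollified n : measurable_fun setT (fun w => mollified n (X w)).
Proof.
under eq_fun do rewrite mollifiedE.
apply: measurable_funeM.
exact: (measurable_fun_fubini_tonelli_F _ (mker n) (ker_ge0 n)).
Qed.

(** Tonelli's theorem, for a nonnegative phi, moves the expectation onto the
    kernel. *)
Lemma integral_mollified n : (\int[P]_w mollified n (X w) =
  n.+1%:R%:E * \int[mu]_y ((phi y)%:E * (\int[P]_w fejer ((y - X w) * n.+1%:R))%:E))%E.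
Proof.
under eq_integral do rewrite mollifiedE.
rewrite ge0_integralZl//=.
- congr (_ * _)%E.
  rewrite (fubini_tonelli _ (mker n) (ker_ge0 n))/=.
  apply: eq_integral => y _.
  have mfX : measurable_fun setT (fun w => fejer ((y - X w) * n.+1%:R)).
    apply: measurableT_comp; first exact: measurable_fejer.
    by apply: measurable_funM => //; exact: measurable_funB.
  under eq_integral do rewrite EFinM.
  rewrite ge0_integralZl//=.
  + congr (_ * _)%E; rewrite /Rintegral fineK//; apply: integrable_fin_num => //.
    apply: (@bounded_integrable _ _ _ _ _ 1) => // w.
    by rewrite ger0_norm ?fejer_ge0 ?fejer_le1.
  + exact/measurable_EFinP.
  + by move=> w _; rewrite lee_fin fejer_ge0.
  + by rewrite lee_fin.
- exact: (measurable_fun_fubini_tonelli_F _ (mker n) (ker_ge0 n)).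
- by move=> w _; apply: integral_ge0 => y _; exact: (ker_ge0 n (w, y)).
Qed.

Lemma cvg_integral_mollified :
  (fun n => \int[P]_w mollified n (X w))%E @ \oo -->
  ((\int[P]_w (phi (X w))%:E) * fejer_mass R)%E.
Proof.
have mphiX : measurable_fun setT (fun w => (phi (X w))%:E).
  by apply/measurable_EFinP; exact: measurableT_comp mphi mX.
have -> : ((\int[P]_w (phi (X w))%:E) * fejer_mass R =
    \int[P]_w ((phi (X w))%:E * fejer_mass R))%E.
  rewrite ge0_integralZr//; last exact/ltW/fejer_mass_gt0.
  by move=> w _; rewrite lee_fin.
have [] := @dominated_convergence _ T R P setT measurableT
  (fun n w => mollified n (X w)) (fun w => (phi (X w))%:E * fejer_mass R)%E
  (fun w => M%:E * fejer_mass R)%E _ _ _ _ _ => //.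
- exact: measurable_mollified.
- by apply: emeasurable_funM.
- by apply/aeW => w _; exact: cvg_mollified.
- by rewrite -(fineK (fejer_mass_fin R)) -EFinM; exact: finite_measure_integrable_cst.
- apply/aeW => w n _; rewrite gee0_abs ?mollified_ge0//.
  exact: mollified_le.
Qed.

End law.
End mollification.

Section charfun_uniqueness.
Context d1 d2 (T1 : measurableType d1) (T2 : measurableType d2) (R : realType).
Context (P1 : probability T1 R) (P2 : probability T2 R).
Variables (X1 : T1 -> measurableTypeR R) (X2 : T2 -> measurableTypeR R).
Hypotheses (mX1 : measurable_fun setT X1) (mX2 : measurable_fun setT X2).
Hypothesis Ecos : forall l, \int[P1]_w cos (l * X1 w) = \int[P2]_w cos (l * X2 w).
Hypothesis Esin : forall l, \int[P1]_w sin (l * X1 w) = \int[P2]_w sin (l * X2 w).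

Let charfun_eq_fejer y k :
  \int[P1]_w fejer ((y - X1 w) * k) = \int[P2]_w fejer ((y - X2 w) * k).
Proof.
rewrite !integral_fejer_charfun//; apply: eq_Rintegral => l _.
by rewrite Ecos Esin.
Qed.

Let charfun_unique_ge0 (phi : R -> R) M : continuous phi ->
  (forall x, 0 <= phi x) -> (forall x, phi x <= M) ->
  \int[P1]_w phi (X1 w) = \int[P2]_w phi (X2 w).
Proof.
move=> cphi phi0 phiM.
have c1 := cvg_integral_mollified (P := P1) cphi phi0 phiM mX1.
have c2 := cvg_integral_mollified (P := P2) cphi phi0 phiM mX2.
have E n : (\int[P1]_w mollified phi n (X1 w) = \int[P2]_w mollified phi n (X2 w))%E.
  rewrite !(integral_mollified cphi phi0)//; congr (_ * _)%E.
  by apply: eq_integral => y _; rewrite charfun_eq_fejer.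
move: c1; under eq_fun do rewrite E; move=> c1.
have : ((\int[P1]_w (phi (X1 w))%:E) * fejer_mass R =
         (\int[P2]_w (phi (X2 w))%:E) * fejer_mass R)%E.
  exact: (cvg_unique (@ereal_hausdorff R) c1 c2).
have kfin := fejer_mass_fin R; have := fejer_mass_gt0 R.
rewrite -(fineK kfin) lte_fin => k0.
have mphi : measurable_fun setT (phi : measurableTypeR R -> R).
  exact: continuous_measurable_fun.
have phib x : `|phi x| <= M by rewrite ger0_norm.
have f1 : (\int[P1]_w (phi (X1 w))%:E)%E \is a fin_num.
  apply: integrable_fin_num => //; apply: (@bounded_integrable _ _ _ _ _ M) => //.
  exact: measurableT_comp.
have f2 : (\int[P2]_w (phi (X2 w))%:E)%E \is a fin_num.
  apply: integrable_fin_num => //; apply: (@bounded_integrable _ _ _ _ _ M) => //.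
  exact: measurableT_comp.
rewrite -(fineK f1) -(fineK f2) -!EFinM => -[] /mulIf; apply.
by rewrite gt_eqF.
Qed.

(** Two random variables with the same characteristic function give the same
    expectation to every mollification of phi, hence to phi in the limit.
    A bounded phi is first made nonnegative by adding a constant. *)
Lemma charfun_unique (phi : R -> R) M : continuous phi ->
  (forall x, `|phi x| <= M) -> \int[P1]_w phi (X1 w) = \int[P2]_w phi (X2 w).
Proof.
move=> cphi phiM.
have mphi : measurable_fun setT (phi : measurableTypeR R -> R) by exact: continuous_measurable_fun.
have phiMX1 : P1.-integrable setT (EFin \o (phi \o X1)).
  apply: (@bounded_integrable _ _ _ _ _ M) => [|w]; last exact: phiM.
  exact: (measurableT_comp mphi mX1).
have phiMX2 : P2.-integrable setT (EFin \o (phi \o X2)).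
  apply: (@bounded_integrable _ _ _ _ _ M) => [|w]; last exact: phiM.
  exact: (measurableT_comp mphi mX2).
have : \int[P1]_w (phi (X1 w) + M) = \int[P2]_w (phi (X2 w) + M).
  apply: (@charfun_unique_ge0 (fun x => phi x + M) (M + M)).
  - by move=> x; apply: cvgD; [exact: cphi|exact: cvg_cst].
  - by move=> x; have := phiM x; rewrite ler_norml => /andP[]; lra.
  - by move=> x; have := phiM x; rewrite ler_norml => /andP[]; lra.
rewrite !RintegralD//; try exact: finite_measure_integrable_cst.
by rewrite !Rintegral_prob_cst => /addIr.
Qed.

End charfun_uniqueness.

(** * Strictly stable laws *)

(** The characteristic function of the law is exp(- A + i B), with A and B
    homogeneous of degree alpha along positive dilations.  Homogeneity is what
    makes the law strictly stable, and the bounds control the tails. *)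
Definition stable_law (R : realType) (P : probability (measurableTypeR R) R)
    (alpha : R) (A B : R -> R) : Prop :=
  [/\ forall l, \int[P]_v cos (l * v) = expR (- A l) * cos (B l) /\
                \int[P]_v sin (l * v) = expR (- A l) * sin (B l),
      forall a l, 0 <= a -> A (a * l) = a `^ alpha * A l /\
                            B (a * l) = a `^ alpha * B l &
      forall l, `|A l| <= `|l| `^ alpha /\ `|B l| <= `|l| `^ alpha].

Section stable_law.
Context (R : realType) (P : probability (measurableTypeR R) R).
Variables (alpha : R) (A B : R -> R).
Hypothesis alpha0 : 0 < alpha.
Hypothesis PAB : stable_law P alpha A B.

Let Ecos l : \int[P]_v cos (l * v) = expR (- A l) * cos (B l).
Proof. by case: PAB => /(_ l)[]. Qed.

Let Esin l : \int[P]_v sin (l * v) = expR (- A l) * sin (B l).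
Proof. by case: PAB => /(_ l)[]. Qed.

Let homA a l : 0 <= a -> A (a * l) = a `^ alpha * A l.
Proof. by case: PAB => _ h _ /(h _ l)[]. Qed.

Let homB a l : 0 <= a -> B (a * l) = a `^ alpha * B l.
Proof. by case: PAB => _ h _ /(h _ l)[]. Qed.

Let boundA l : `|A l| <= `|l| `^ alpha.
Proof. by case: PAB => _ _ /(_ l)[]. Qed.

Let boundB l : `|B l| <= `|l| `^ alpha.
Proof. by case: PAB => _ _ /(_ l)[]. Qed.

Let mid : measurable_fun setT (id : measurableTypeR R -> measurableTypeR R).
Proof. exact: measurable_id. Qed.

Let mcos (l : R) : measurable_fun setT (fun v : measurableTypeR R => cos (l * v)).
Proof. exact: (measurable_cosX mid). Qed.

Let msin (l : R) : measurable_fun setT (fun v : measurableTypeR R => sin (l * v)).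
Proof. exact: (measurable_sinX mid). Qed.

Section convolution.
Variables (a b c : R).
Hypotheses (a0 : 0 <= a) (b0 : 0 <= b) (c0 : 0 <= c).
Hypothesis abc : c `^ alpha = a `^ alpha + b `^ alpha.

Let X (z : measurableTypeR R * measurableTypeR R) : measurableTypeR R := a * z.1 + b * z.2.

Let mX : measurable_fun setT X.
Proof. by apply: measurable_funD; apply: measurable_funM. Qed.

Let ic l : P.-integrable setT (EFin \o fun v => cos (l * v)).
Proof. exact: bounded_integrable (mcos l) (fun v => cos_max _). Qed.

Let isn l : P.-integrable setT (EFin \o fun v => sin (l * v)).
Proof. exact: bounded_integrable (msin l) (fun v => sin_max _). Qed.

Let charA l : A (l * c) = A (l * a) + A (l * b).
Proof. by rewrite !(mulrC l) !homA// -mulrDl abc. Qed.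

Let charB l : B (l * c) = B (l * a) + B (l * b).
Proof. by rewrite !(mulrC l) !homB// -mulrDl abc. Qed.

Let Ecos_conv l : \int[(P \x P)%E]_z cos (l * X z) = \int[P]_v cos (l * (c * v)).
Proof.
rewrite (bounded_Rintegral_prod P P (measurable_cosX mX l) (fun z => cos_max _)).
under [RHS]eq_Rintegral do rewrite mulrA.
rewrite [RHS]Ecos charA charB opprD expRD cosD.
transitivity (\int[P]_v (cos (l * a * v) * (expR (- A (l * b)) * cos (B (l * b))) -
                         sin (l * a * v) * (expR (- A (l * b)) * sin (B (l * b))))).
  apply: eq_Rintegral => v _; rewrite -Ecos -Esin -!RintegralZl// -RintegralB//; last 2 first.
  - exact: (integrableZl _ _ (ic _)).
  - exact: (integrableZl _ _ (isn _)).
  by apply: eq_Rintegral => w _; rewrite -cosD; congr cos; rewrite /X /=; ring.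
rewrite RintegralB//; last 2 first.
- exact: (integrableZr _ _ (ic _)).
- exact: (integrableZr _ _ (isn _)).
rewrite !RintegralZr// Ecos Esin; ring.
Qed.

Let Esin_conv l : \int[(P \x P)%E]_z sin (l * X z) = \int[P]_v sin (l * (c * v)).
Proof.
rewrite (bounded_Rintegral_prod P P (measurable_sinX mX l) (fun z => sin_max _)).
under [RHS]eq_Rintegral do rewrite mulrA.
rewrite [RHS]Esin charA charB opprD expRD sinD.
transitivity (\int[P]_v (sin (l * a * v) * (expR (- A (l * b)) * cos (B (l * b))) +
                         cos (l * a * v) * (expR (- A (l * b)) * sin (B (l * b))))).
  apply: eq_Rintegral => v _; rewrite -Ecos -Esin -!RintegralZl// -RintegralD//; last 2 first.
  - exact: (integrableZl _ _ (ic _)).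
  - exact: (integrableZl _ _ (isn _)).
  by apply: eq_Rintegral => w _; rewrite -sinD; congr sin; rewrite /X /=; ring.
rewrite RintegralD//; last 2 first.
- exact: (integrableZr _ _ (isn _)).
- exact: (integrableZr _ _ (ic _)).
rewrite !RintegralZr// Ecos Esin; ring.
Qed.

(** The sum of a V and b V', with V and V' independent, has the characteristic
    function of c V: by homogeneity the exponents add up. *)
Lemma stable_convolution (phi : R -> R) M x : continuous phi ->
  (forall y, `|phi y| <= M) ->
  \int[P]_v \int[P]_w phi (x - a * v - b * w) = \int[P]_v phi (x - c * v).
Proof.
move=> cphi phiM; pose psi y := phi (x - y).
have cpsi : continuous psi.
  move=> y; apply: (@cvg_comp _ _ _ (fun y => x - y) phi _ _ _ _ (cphi (x - y))).
  by apply: cvgB; [exact: cvg_cst|exact: cvg_id].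
have mpsi : measurable_fun setT (psi : measurableTypeR R -> R).
  exact: continuous_measurable_fun.
have mc : measurable_fun setT (fun v : measurableTypeR R => c * v : measurableTypeR R).
  exact: measurable_funM.
have := charfun_unique mX mc Ecos_conv Esin_conv cpsi (fun y => phiM (x - y)).
rewrite (bounded_Rintegral_prod P P (measurableT_comp mpsi mX) (fun z => phiM _)) => <-.
by apply: eq_Rintegral => v _; apply: eq_Rintegral => w _; rewrite /psi /X /= opprD addrA.
Qed.

End convolution.

(* A linear bound is enough here: it is applied to B l, itself of order
   |l|^alpha. *)
Let one_sub_cos_le (x : R) : 1 - cos x <= `|x|.
Proof.
rewrite -cos_norm; move: `|x| (normr_ge0 x) => {}x x0.
have [y _ E] : exists2 y, y \in `[0, x]%R & cos x - cos 0 = - sin y * (x - 0).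
  apply: MVT_segment => //.
  exact/continuous_subspaceT/continuous_cos.
rewrite cos0 subr0 in E; rewrite -opprB E mulNr opprK.
by rewrite ler_piMl// sin_le1.
Qed.

Let K := 2 + expR 1 : R.

Let K0 : 0 < K. Proof. by rewrite addr_gt0// expR_gt0. Qed.

Let Ecos_ge l : 1 - K * `|l| `^ alpha <= \int[P]_v cos (l * v).
Proof.
have := boundA l; have := boundB l; have := powR_ge0 `|l| alpha.
set m := `|l| `^ alpha => m0 Bm Am.
have [m1|m1] := leP 1 m.
  have : `|\int[P]_v cos (l * v)| <= 1.
    by apply: norm_bounded_Rintegral => // v; exact: cos_max.
  rewrite ler_norml => /andP[+ _]; apply: le_trans.
  have : 2 * 1 <= K * m by rewrite ler_pM// /K lerDl expR_ge0.
  by lra.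
rewrite Ecos.
have e1 : 1 - m <= expR (- A l).
  apply: le_trans (expR_ge1Dx _); move: Am; rewrite ler_norml => /andP[_].
  by lra.
have e2 : expR (- A l) <= expR 1.
  by rewrite ler_expR; move: Am; rewrite ler_norml => /andP[]; lra.
have : expR (- A l) * (1 - cos (B l)) <= expR 1 * m.
  apply: ler_pM; rewrite ?expR_ge0 ?subr_ge0 ?cos_le1//.
  exact: le_trans (one_sub_cos_le _) _.
by rewrite /K; lra.
Qed.

(** Truncation inequality: 1 - fejer (k v) is nonnegative, and at least 3/4 when
    |k v| >= 4, while its expectation is an average of 1 - E cos(l k V) over l in
    [0, 1], which is of order k^alpha.  The choice k = 4 / rho gives the tail
    beyond rho. *)
Lemma stable_tail : exists2 C : R, 0 < C &
  forall rho (h : measurableTypeR R -> R), 0 < rho -> measurable_fun setT h ->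
    (forall v, 0 <= h v <= 1) -> (forall v, `|v| < rho -> h v = 0) ->
    \int[P]_v h v <= C / rho `^ alpha.
Proof.
exists (4 / 3 * K * 4 `^ alpha) => [|rho h rho0 mh h01 hrho].
  by rewrite !mulr_gt0// powR_gt0.
pose k := 4 / rho.
have k0 : 0 < k by rewrite divr_gt0.
have mf : measurable_fun setT (fun v : measurableTypeR R => fejer ((0 - v) * k)).
  apply: measurableT_comp; first exact: measurable_fejer.
  by apply: measurable_funM => //; exact: measurable_funB.
have fb v : `|fejer ((0 - v) * k)| <= 1 by rewrite ger0_norm ?fejer_ge0 ?fejer_le1.
have hle v : h v <= 4 / 3 * (1 - fejer ((0 - v) * k)).
  have [vr|vr] := ltP `|v| rho.
    by rewrite hrho// mulr_ge0// subr_ge0 fejer_le1.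
  have /andP[_ h1] := h01 v; apply: le_trans h1 _.
  have := fejer_mul_sqr ((0 - v) * k).
  have : 16 <= ((0 - v) * k) ^+ 2.
    have -> : 16 = 4 ^+ 2 :> R by ring.
    rewrite -[leRHS]real_normK ?num_real// ler_sqr ?nnegrE//.
    by rewrite sub0r normrM normrN (gtr0_norm k0) /k mulrCA ler_peMr// ler_pdivlMr// mul1r.
  move: (fejer_ge0 ((0 - v) * k)); move: (fejer _) (_ ^+ 2) => y q.
  by nra.
have F : 1 - K * k `^ alpha <= \int[P]_v fejer ((0 - v) * k).
  rewrite (integral_fejer_charfun P mid).
  under eq_Rintegral do rewrite !mulr0 cos0 sin0 mul1r mul0r addr0.
  pose q := 1 - K * k `^ alpha.
  pose G (l : measurableTypeR R) := \int[P]_v cos (l * k * v).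
  have Gb l : `|G l| <= 1.
    by apply: norm_bounded_Rintegral => // v; exact: cos_max.
  have mG : measurable_fun setT G.
    have mh2 : measurable_fun setT
        (fun z : measurableTypeR R * measurableTypeR R => cos (z.1 * k * z.2)).
      apply: measurableT_comp; first exact: continuous_measurable_fun (@continuous_cos R).
      by apply: measurable_funM => //; exact: measurable_funM.
    exact: (measurable_Rintegral2 P P mh2 (fun z => cos_max _)).
  rewrite (fejer_law_support (h2 := fun l => Num.max q (G l))) -/q//.
  - rewrite -[leLHS](Rintegral_prob_cst (fejer_law R)).
    apply: (@le_bounded_Rintegral _ _ _ _ _ _ (`|q| + 1)) => //.
    + exact: measurable_maxr.
    + by move=> l; rewrite lerDl.
    + move=> l; rewrite /Num.max; case: ifP => _; last by rewrite lerDl.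
      by rewrite (le_trans (Gb l))// lerDr.
    + by move=> l; rewrite le_max lexx.
  - exact: measurable_maxr.
  - move=> l; rewrite in_itv/= => /andP[l0 l1]; apply/esym/max_idPr.
    apply: le_trans (Ecos_ge _); rewrite /q lerD2l lerN2 ler_pM2l//.
    rewrite normrM (gtr0_norm k0) (ger0_norm l0); apply: ge0_ler_powR.
    + exact: ltW.
    + by rewrite nnegrE mulr_ge0// ltW.
    + by rewrite nnegrE ltW.
    + by rewrite ler_piMl// ltW.
have hb v : `|h v| <= 8 / 3.
  by have /andP[h0 h1] := h01 v; rewrite ger0_norm//; lra.
apply: (@le_trans _ _ (\int[P]_v (4 / 3 * (1 - fejer ((0 - v) * k))))).
  apply: (@le_bounded_Rintegral _ _ _ _ _ _ (8 / 3)) => //.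
  - by apply: measurable_funM => //; exact: measurable_funB.
  - move=> v; have := fejer_ge0 ((0 - v) * k); have := fejer_le1 ((0 - v) * k).
    by move=> f1 f0; rewrite ger0_norm; lra.
have if' := bounded_integrable P mf fb.
have i1 : P.-integrable setT (EFin \o (fun _ : measurableTypeR R => 1 : R)).
  exact: finite_measure_integrable_cst.
rewrite RintegralZl//; last exact: (integrableB _ i1 if').
rewrite RintegralB// Rintegral_prob_cst.
have -> : 4 / 3 * K * 4 `^ alpha / rho `^ alpha = 4 / 3 * (K * k `^ alpha).
  rewrite /k powRM ?invr_ge0 ?(ltW rho0)//.
  rewrite -(powR_inv1 (ltW rho0)) -powRrM mulN1r powRN.
  ring.
by rewrite ler_pM2l ?divr_gt0//; lra.
Qed.

End stable_law.

Section stable_density_law.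
Context (R : realType).
Local Notation mu := (@lebesgue_measure R).
Variables (alpha beta : R) (f : R -> R).
Hypothesis alpha0 : 0 < alpha.
Hypothesis hf : stable_density alpha beta f.

(* The symbol is |l|^alpha exp(- i phase l), so that its opposite is - A + i B
   with A and B as below. *)
Let phase (l : R) := pi / 2 * Num.sg l * Defs.skew alpha beta.

Let A l := `|l| `^ alpha * cos (phase l).

Let B l := `|l| `^ alpha * sin (phase l).

Let charfun_density l :
  \int[mu]_x (f x * cos (l * x)) = expR (- A l) * cos (B l) /\
  \int[mu]_x (f x * sin (l * x)) = expR (- A l) * sin (B l).
Proof.
have E1 z : expR (- (expR (- 0) * cos (- phase l) * `|l| `^ alpha -
    expR (- 0) * sin (- phase l) * 0)) = z -> expR (- A l) = z.
  by rewrite oppr0 expR0 cosN mulr0 subr0 mul1r mulrC.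
have E2 : - (expR (- 0) * cos (- phase l) * 0 +
    expR (- 0) * sin (- phase l) * `|l| `^ alpha) = B l.
  by rewrite mulr0 add0r oppr0 expR0 sinN mul1r mulNr opprK mulrC.
case: hf => _ _ _ /(_ l); rewrite /Cintegral /symbol /= -/(phase l) E2.
rewrite -(E1 _ erefl) => -[<- <-]; split.
  by apply: eq_Rintegral => x _; rewrite expR0 !mul1r mulr0 subr0 mulrC.
by apply: eq_Rintegral => x _; rewrite expR0 !mul1r mulr0 add0r mulrC.
Qed.

(** The exponent of the characteristic function is minus the symbol, which is
    homogeneous of degree alpha because its argument depends only on the sign
    of l. *)
Lemma stable_density_law : exists P : probability (measurableTypeR R) R,
  exists A B : R -> R, stable_law P alpha A B /\
    forall h : measurableTypeR R -> R, measurable_fun setT h ->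
      \int[P]_v h v = \int[mu]_v (f v * h v).
Proof.
case: (hf) => mf f0 f1 _.
have [P PE] := density_probability mf f0 f1.
have PEh := Rintegral_density mf f0 PE.
exists P, A, B; split; last by [].
split=> [l|a l a0|l].
- rewrite !PEh; first exact: charfun_density.
    exact: (measurable_sinX (@measurable_id _ _ setT)).
  exact: (measurable_cosX (@measurable_id _ _ setT)).
- move: a0; rewrite le_eqVlt => /predU1P[<-|a0].
    by rewrite /A /B mul0r normr0 powR0 ?mul0r// gt_eqF.
  rewrite /A /B {1 3}/phase sgrM (gtr0_sg a0) mul1r -!/(phase l).
  by rewrite normrM powRM// gtr0_norm// !mulrA.
- rewrite /A /B !normrM (ger0_norm (powR_ge0 _ _)).
  by rewrite !ler_piMr ?powR_ge0 ?cos_max ?sin_max.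
Qed.

End stable_density_law.

(** * The stable semigroup *)

(** The operator S(t) as an expectation.  At t = 0 the formula gives the
    identity since 0 ^ (1/alpha) = 0, so that it covers all t >= 0. *)
Definition evolve (R : realType) (P : probability (measurableTypeR R) R)
    (alpha t : R) (phi : R -> R) (x : R) : R :=
  \int[P]_v phi (x - t `^ alpha^-1 * v).

Section stable_semigroup.
Context (R : realType).
Variables (alpha : R) (f : R -> R) (P : probability (measurableTypeR R) R).
Hypothesis alpha0 : 0 < alpha.
Hypothesis mf : measurable_fun setT (f : measurableTypeR R -> R).
Hypothesis PE : forall h : measurableTypeR R -> R, measurable_fun setT h ->
  \int[P]_v h v = \int[lebesgue_measure]_v (f v * h v).

Lemma semigroupE t (phi : R -> R) x : 0 <= t ->
  measurable_fun setT (phi : measurableTypeR R -> R) ->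
  semigroup f alpha t phi x = evolve P alpha t phi x.
Proof.
move=> t0 mphi; rewrite /semigroup /evolve.
have mx (b : R) : measurable_fun setT (fun v : measurableTypeR R => phi (x - b * v)).
  by apply: measurableT_comp mphi _; apply: measurable_funB => //; apply: measurable_funM.
case: ifPn => tpos; last first.
  have -> : t = 0 by apply/eqP; rewrite eq_le t0 leNgt tpos.
  rewrite powR0 ?invr_eq0 ?gt_eqF//; under eq_Rintegral do rewrite mul0r subr0.
  by rewrite Rintegral_prob_cst.
set b := t `^ alpha^-1.
have b0 : 0 < b by exact: powR_gt0.
rewrite PE;  last exact: mx.
rewrite -[RHS](Rintegral_convolution x b0); last exact: measurable_funM mf (mx b).
apply: eq_Rintegral => y _; rewrite powRN -/b -mulrA; congr (_ * (_ * phi _)).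
by rewrite mulrC divfK ?gt_eqF// opprB addrC subrK.
Qed.

End stable_semigroup.

Section evolve.
Context (R : realType) (P : probability (measurableTypeR R) R).
Variables (alpha : R) (A B : R -> R).
Hypothesis alpha0 : 0 < alpha.
Hypothesis PAB : stable_law P alpha A B.

Local Notation evolve := (evolve P alpha).

Definition bounded_measurable (M : R) (phi : R -> R) :=
  measurable_fun setT (phi : measurableTypeR R -> R) /\ forall x, `|phi x| <= M.

Lemma continuous_bounded_measurable M phi : continuous phi -> (forall x, `|phi x| <= M) ->
  bounded_measurable M phi.
Proof. by move=> cphi phiM; split => //; exact: continuous_measurable_fun. Qed.

Let msub t x phi M : bounded_measurable M phi ->
  measurable_fun setT (fun v : measurableTypeR R => phi (x - t `^ alpha^-1 * v)).
Proof.
move=> [mphi _]; apply: measurableT_comp mphi _.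
by apply: measurable_funB => //; apply: measurable_funM.
Qed.

Let isub t x phi M : bounded_measurable M phi ->
  P.-integrable setT (EFin \o fun v => phi (x - t `^ alpha^-1 * v)).
Proof.
move=> phiM; apply: (@bounded_integrable _ _ _ _ _ M); first exact: msub phiM.
by move=> v; exact: phiM.2.
Qed.

Lemma evolve_bounded_measurable t phi M :
  bounded_measurable M phi -> bounded_measurable M (evolve t phi).
Proof.
move=> phiM; split; last first.
  move=> x; apply: norm_bounded_Rintegral; first exact: msub phiM.
  by move=> v; exact: phiM.2.
pose h (z : measurableTypeR R * measurableTypeR R) := phi (z.1 - t `^ alpha^-1 * z.2).
have mh : measurable_fun setT h.
  apply: measurableT_comp phiM.1 _.
  by apply: measurable_funB => //; apply: measurable_funM.
exact: (measurable_Rintegral2 P P mh (fun z => phiM.2 _)).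
Qed.

Lemma evolve0 phi x : evolve 0 phi x = phi x.
Proof.
rewrite /evolve powR0 ?invr_eq0 ?gt_eqF//.
by under eq_Rintegral do rewrite mul0r subr0; rewrite Rintegral_prob_cst.
Qed.

Lemma evolve_le t phi psi M M' x : bounded_measurable M phi -> bounded_measurable M' psi ->
  (forall z, phi z <= psi z) -> evolve t phi x <= evolve t psi x.
Proof.
move=> hphi hpsi le; apply: le_Rintegral => //.
- exact: isub hphi.
- exact: isub hpsi.
Qed.

Lemma evolveZ t c phi M x : bounded_measurable M phi ->
  evolve t (fun z => c * phi z) x = c * evolve t phi x.
Proof. by move=> hphi; rewrite /evolve RintegralZl//; exact: isub hphi. Qed.

Lemma evolveD t phi psi M M' x : bounded_measurable M phi -> bounded_measurable M' psi ->
  evolve t (fun z => phi z + psi z) x = evolve t phi x + evolve t psi x.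
Proof.
by move=> hphi hpsi; rewrite /evolve RintegralD//; [exact: isub hphi|exact: isub hpsi].
Qed.

Lemma evolve_cst t c x : evolve t (fun=> c) x = c.
Proof. exact: Rintegral_prob_cst. Qed.

Lemma bounded_measurableD M M' phi psi : bounded_measurable M phi -> bounded_measurable M' psi ->
  bounded_measurable (M + M') (fun z => phi z + psi z).
Proof.
move=> [m1 b1] [m2 b2]; split; first exact: measurable_funD.
by move=> x; rewrite (le_trans (ler_normD _ _))// lerD.
Qed.

Lemma bounded_measurableZ M c phi : bounded_measurable M phi ->
  bounded_measurable (`|c| * M) (fun z => c * phi z).
Proof.
move=> [m1 b1]; split; first exact: measurable_funM.
by move=> x; rewrite normrM ler_wpM2l.
Qed.

(** The bound on the sum is carried along the induction, since additivity of
    the integral requires it at each step. *)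
Lemma evolve_sum t (n : nat) (c : nat -> R) (h : nat -> R -> R) M x :
  (forall i, (i < n)%N -> bounded_measurable M (h i)) ->
  (exists M', bounded_measurable M' (fun z => \sum_(i < n) c i * h i z)) /\
  evolve t (fun z => \sum_(i < n) c i * h i z) x = \sum_(i < n) c i * evolve t (h i) x.
Proof.
elim: n => [|n IH] hb.
  have E : (fun z => \sum_(i < 0) c i * h i z) = (fun=> 0).
    by apply/funext => z; rewrite big_ord0.
  rewrite E evolve_cst big_ord0; split => //; exists 0; split=> [|z].
    exact: measurable_cst.
  by rewrite normr0.
have {IH} [[M' hM'] E] := IH (fun i ni => hb i (ltnW ni)).
have hn := hb n (ltnSn n).
have E' : (fun z => \sum_(i < n.+1) c i * h i z) =
          (fun z => \sum_(i < n) c i * h i z + c n * h n z).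
  by apply/funext => z; rewrite big_ord_recr.
rewrite E' big_ord_recr /= -E; split.
  by exists (M' + `|c n| * M); apply: bounded_measurableD => //; exact: bounded_measurableZ.
by rewrite (evolveD _ _ hM' (bounded_measurableZ _ hn)) (evolveZ _ _ _ hn).
Qed.

Lemma evolve_semigroup (s t : R) (phi : R -> R) M x : 0 <= s -> 0 <= t ->
  continuous phi -> (forall z, `|phi z| <= M) ->
  evolve t (evolve s phi) x = evolve (t + s) phi x.
Proof.
move=> s0 t0 cphi phiM; rewrite /evolve.
apply: (stable_convolution PAB _ _ _ _ _ cphi phiM); rewrite ?powR_ge0//.
by rewrite -!powRrM mulVf ?gt_eqF// !powRr1// addr_ge0.
Qed.

(** From a point at depth D below b, the region above b is reached only through
    a jump t^(1/alpha) |V| >= D. *)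
Lemma evolve_tail : exists2 C : R, 0 < C &
  forall t (h : R -> R) x b D, 0 <= t -> 0 < D -> x <= b - D -> bounded_measurable 1 h ->
    (forall z, 0 <= h z) -> (forall z, z <= b -> h z = 0) ->
    evolve t h x <= C * t / D `^ alpha.
Proof.
have [C C0 tail] := stable_tail alpha0 PAB.
exists C => // t h x b D; rewrite le_eqVlt => /predU1P[<-|t0] D0 xb hM h0 hb.
  by rewrite evolve0 hb ?mulr0 ?mul0r//; lra.
have a0 : 0 < t `^ alpha^-1 by exact: powR_gt0.
have -> : C * t / D `^ alpha = C / (D / t `^ alpha^-1) `^ alpha.
  have aalpha : (t `^ alpha^-1) `^ alpha = t.
    by rewrite -powRrM mulVf ?gt_eqF// powRr1// ltW.
  have -> : (D / t `^ alpha^-1) `^ alpha = D `^ alpha / t.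
    rewrite powRM ?invr_ge0 ?(ltW D0) ?(ltW a0)// -[in RHS]aalpha.
    by rewrite -{1}(powR_inv1 (ltW a0)) -[in LHS]powRrM mulN1r powRN.
  by rewrite invfM invrK mulrAC mulrA.
apply: tail.
- exact: divr_gt0.
- exact: msub hM.
- by move=> v; rewrite h0/= (le_trans (ler_norm _))// hM.2.
- move=> v; rewrite ltr_pdivlMr// => vD; apply: hb.
  have : - (t `^ alpha^-1 * v) <= `|v| * t `^ alpha^-1.
    by rewrite -mulrN mulrC ler_pM2r// -normrN ler_norm.
  by lra.
Qed.

End evolve.

(** * Riemann sums and relaxation of a scalar function *)

Section riemann_increment.
Context (R : realType).

Lemma sum_ord_add (F : nat -> R) n m :
  \sum_(i < n + m) F i = \sum_(i < n) F i + \sum_(i < m) F (n + i)%N.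
Proof. exact: big_split_ord. Qed.

(** Riemann integrability on [0, b] with value I, in the tagged partition form
    used for curves of functions. *)
Definition is_riemann_sum_limit (k : R -> R) (b I : R) : Prop :=
  forall eps : R, 0 < eps -> exists2 delta : R, 0 < delta &
    forall (n : nat) (sg tau : nat -> R), tagged_partition 0 b delta n sg tau ->
      `|I - \sum_(i < n) (sg i.+1 - sg i) * k (tau i)| <= eps.

(** The integral over [0, s'] is computed along a partition that passes through
    s, so that its difference with the integral over [0, s] is a Riemann sum
    over [s, s'], bounded termwise. *)
Lemma riemann_increment (k : R -> R) (s s' I I' C : R) : 0 <= s -> s <= s' ->
  is_riemann_sum_limit k s I -> is_riemann_sum_limit k s' I' ->
  (forall q, s <= q <= s' -> k q <= C) -> I' - I <= C * (s' - s).
Proof.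
move=> s0 ss' lim lim' kC; apply/ler_addgt0Pr => eps eps0.
have e2 : 0 < eps / 2 by rewrite divr_gt0.
have [d1 d10 H1] := lim _ e2.
have [d2 d20 H2] := lim' _ e2.
have [n [npos N1 N2 N3]] : exists n : nat,
    [/\ (0 < n)%N, s / n%:R < d1, s / n%:R < d2 & (s' - s) / n%:R < d2].
  pose b := Num.max (s / d1) (Num.max (s / d2) ((s' - s) / d2)).
  exists (Num.bound b).+1; have bN : b < (Num.bound b).+1%:R.
    apply: lt_trans (archi_boundP _) _; last by rewrite ltr_nat.
    by rewrite le_max divr_ge0// ltW.
  move: bN; rewrite !gt_max => /and3P[b1 b2 b3].
  by split=> //; rewrite ltr_pdivrMr ?ltr0n// mulrC -ltr_pdivrMr.
have n0 : 0 < n%:R :> R by rewrite ltr0n.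
pose sg1 (i : nat) : R := i%:R * (s / n%:R).
(* n equal steps on [0, s], followed by n equal steps on [s, s']. *)
pose sg2 (i : nat) : R :=
  if (i <= n)%N then i%:R * (s / n%:R) else s + (i - n)%:R * ((s' - s) / n%:R).
have sn0 : 0 <= s / n%:R by rewrite divr_ge0// ltW.
have ssn0 : 0 <= (s' - s) / n%:R by rewrite divr_ge0 ?subr_ge0// ltW.
have nsn (z : R) : n%:R * (z / n%:R) = z by rewrite mulrC divfK// gt_eqF.
have p1 : tagged_partition 0 s d1 n sg1 sg1.
  split; rewrite /sg1 ?mul0r ?nsn// => i _.
  by rewrite lexx/= -natr1; lra.
have p2 : tagged_partition 0 s' d2 (n + n) sg2 sg2.
  split; rewrite /sg2 ?mul0r//.
    by rewrite -[X in (_ <= X)%N]addn0 leq_add2l leqNgt npos /= addnK nsn addrC subrK.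
  move=> i _; rewrite lexx/=; case: (ltnP i n) => [ni|ni].
    by rewrite ltnW// -natr1; lra.
  case: (ltngtP i n) ni => // [ni _|-> _].
    by rewrite subSn 1?ltnW// -natr1; lra.
  by rewrite nsn subSnn mul1r; lra.
have {}H1 := H1 _ _ _ p1; have {}H2 := H2 _ _ _ p2.
pose F i := (sg2 i.+1 - sg2 i) * k (sg2 i).
have headE : \sum_(i < n) F i = \sum_(i < n) (sg1 i.+1 - sg1 i) * k (sg1 i).
  by apply: eq_bigr => i _; rewrite /F /sg2 ltn_ord ltnW ?ltn_ord.
have tailE : \sum_(i < n) F (n + i)%N <= C * (s' - s).
  have -> : C * (s' - s) = \sum_(i < n) (s' - s) / n%:R * C.
    by rewrite sumr_const card_ord -[RHS]mulr_natl mulrA nsn mulrC.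
  apply: ler_sum => i _.
  have sgE j : sg2 (n + j)%N = s + j%:R * ((s' - s) / n%:R).
    rewrite /sg2; case: leqP => [|_]; last by rewrite addKn.
    rewrite -[X in (_ <= X)%N]addn0 leq_add2l leqn0 => /eqP ->.
    by rewrite addn0 nsn mul0r addr0.
  rewrite /F -addnS !sgE -natr1.
  have -> : s + (i%:R + 1) * ((s' - s) / n%:R) - (s + i%:R * ((s' - s) / n%:R)) =
    (s' - s) / n%:R by ring.
  apply: ler_wpM2l => //; apply: kC; rewrite lerDl mulr_ge0 ?ler0n//=.
  have : i%:R * ((s' - s) / n%:R) <= s' - s.
    by rewrite mulrA ler_pdivrMr// mulrC ler_wpM2l ?subr_ge0// ler_nat ltnW.
  by lra.
move: H2; rewrite -/(F _) (sum_ord_add F) headE => H2.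
move: tailE H1 H2; set X := \sum_(i < n) _; set Y := \sum_(i < n) _ => tailE.
by rewrite !ler_norml => /andP[? ?] /andP[? ?]; lra.
Qed.

End riemann_increment.

Section relaxation.
Context (R : realType).
Variables (y k : R -> R) (a b gam N eta M : R).
Hypotheses (ab : a <= b) (gam0 : 0 < gam) (eta0 : 0 < eta) (M0 : 0 < M).
Hypothesis y_incr : forall s s' C, a <= s -> s <= s' -> s' <= b ->
  (forall q, s <= q <= s' -> k q <= C) -> y s' - y s <= C * (s' - s).
Hypothesis k_le : forall q, a <= q <= b -> k q <= - gam * y q + N.
Hypothesis k_leM : forall q, a <= q <= b -> k q <= M.

Let step s s' : a <= s -> s <= s' -> s' <= b -> M * (s' - s) <= eta / 2 ->
  N / gam + eta < y s' -> y s' + gam * eta / 2 * (s' - s) <= y s.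
Proof.
move=> sa ss s'b small Ly.
suff : y s' - y s <= - (gam * eta / 2) * (s' - s) by lra.
apply: y_incr => // q /andP[sq qs'].
have aqb : a <= q <= b by rewrite (le_trans sa sq) (le_trans qs' s'b).
have yq : y s' - y q <= M * (s' - q).
  apply: y_incr => //; first exact: le_trans sa sq.
  move=> r /andP[qr rs']; apply: k_leM.
  by rewrite (le_trans (le_trans sa sq) qr) (le_trans rs' s'b).
have Msq : M * (s' - q) <= M * (s' - s) by rewrite ler_pM2l// lerD2l lerN2.
have : gam * (N / gam + eta / 2) <= gam * y q by rewrite ler_pM2l//; lra.
rewrite mulrDr mulrCA divff ?gt_eqF// mulr1.
by have := k_le aqb; lra.
Qed.

(** This is the differential inequality y' <= - gam y + N for a function known
    only through integral increments.  Above the level N / gam + eta the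
    function decreases at rate at least gam eta; read backwards from b, it must
    have been larger before.  Half of the rate is given up because, within a
    step, y is only known up to its Lipschitz bound M. *)
Lemma relaxation_backward :
  N / gam + eta < y b -> y b + gam * eta / 2 * (b - a) <= y a.
Proof.
move=> Lyb.
have [n nM] : exists n : nat, 2 * M * (b - a) / eta <= n.+1%:R.
  exists (Num.bound (2 * M * (b - a) / eta)).
  rewrite ltW// (lt_trans (archi_boundP _))//; last by rewrite ltr_nat.
  by rewrite divr_ge0 ?(ltW eta0)// mulr_ge0 ?subr_ge0// mulr_ge0// ltW.
pose del := (b - a) / n.+1%:R.
have n0 : 0 < n.+1%:R :> R by rewrite ltr0n.
have del0 : 0 <= del by rewrite divr_ge0 ?subr_ge0// ltW.
have Mdel : M * del <= eta / 2.
  move: nM; rewrite ler_pdivrMr// => nM.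
  by rewrite /del mulrA ler_pdivrMr//; lra.
have main j : (j <= n.+1)%N -> y b + gam * eta / 2 * (j%:R * del) <= y (b - j%:R * del).
  elim: j => [_|j IH jn]; first by rewrite !mul0r mulr0 addr0 subr0.
  have {}IH := IH (ltnW jn).
  have jdel : j.+1%:R * del <= b - a.
    by rewrite /del mulrC -mulrA ler_piMr ?subr_ge0// mulrC ler_pdivrMr// mul1r ler_nat.
  have E : b - j%:R * del - (b - j.+1%:R * del) = del by rewrite -natr1; ring.
  have jd0 : 0 <= gam * eta / 2 * (j%:R * del).
    apply: mulr_ge0; last by rewrite mulr_ge0 ?ler0n.
    by rewrite divr_ge0 ?mulr_ge0 ?(ltW gam0) ?(ltW eta0).
  have : y (b - j%:R * del) + gam * eta / 2 * (b - j%:R * del - (b - j.+1%:R * del)) <=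
         y (b - j.+1%:R * del).
    apply: step.
    - by lra.
    - by move: E del0; lra.
    - by rewrite gerBl mulr_ge0 ?ler0n.
    - by rewrite E.
    - by lra.
  rewrite E => H; apply: le_trans H.
  by move: IH; rewrite -natr1; lra.
have := main n.+1 (leqnn _).
have -> : n.+1%:R * del = b - a by rewrite /del mulrC divfK// gt_eqF.
by rewrite opprB addrCA subrr addr0.
Qed.

End relaxation.

(** * Mild solutions along backward characteristics *)

Section mild.
Context (R : realType) (P : probability (measurableTypeR R) R).
Variables (alpha : R) (A B : R -> R).
Hypothesis alpha0 : 0 < alpha.
Hypothesis PAB : stable_law P alpha A B.
Local Notation evolve := (evolve P alpha).
Variables (g u0 : R -> R) (u : R -> R -> R) (M : R).
Hypothesis cu : forall t : R, 0 <= t -> continuous (u t).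
Hypothesis u01 : forall t x : R, 0 <= t -> 0 <= u t x <= 1.
Hypothesis cu0 : continuous u0.
Hypothesis u001 : forall x, 0 <= u0 x <= 1.
Hypothesis cgu : forall t : R, 0 <= t -> continuous (g \o u t).
Hypothesis guM : forall t x : R, 0 <= t -> `|g (u t x)| <= M.
Hypothesis mild : forall t eps : R, 0 <= t -> 0 < eps ->
  exists2 delta : R, 0 < delta &
    forall (n : nat) (s tau : nat -> R), tagged_partition 0 t delta n s tau ->
      forall x, `|u t x - evolve t u0 x -
        \sum_(k < n) (s k.+1 - s k) * evolve (t - tau k) (g \o u (tau k)) x| <= eps.

Lemma tagged_partition_bounds (a b delta : R) n (s tau : nat -> R) i :
  tagged_partition a b delta n s tau -> (i < n)%N -> a <= tau i <= b.
Proof.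
move=> [sa sb st] ilt.
have mon m k : (m + k <= n)%N -> s m <= s (m + k)%N.
  elim: k => [|k IH]; first by rewrite addn0.
  rewrite addnS => mk; apply: le_trans (IH (ltnW mk)) _.
  by have [/andP[s1 s2] _] := st _ mk; exact: le_trans s1 s2.
have [/andP[s1 s2] _] := st _ ilt.
rewrite -sa -sb (le_trans _ s1)/=; last by have := mon 0%N i; rewrite add0n; apply; exact: ltnW.
by rewrite (le_trans s2)//; have := mon i.+1 (n - i.+1)%N; rewrite subnKC//; apply.
Qed.

Let u_mb t : 0 <= t -> bounded_measurable 1 (u t).
Proof.
move=> t0; apply: continuous_bounded_measurable; first exact: cu.
by move=> x; have /andP[? ?] := u01 x t0; rewrite ger0_norm.
Qed.

Let u0b x : `|u0 x| <= 1.
Proof. by have /andP[? ?] := u001 x; rewrite ger0_norm. Qed.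

Let u0_mb : bounded_measurable 1 u0.
Proof. exact: continuous_bounded_measurable. Qed.

Let gu_mb t : 0 <= t -> bounded_measurable M (g \o u t).
Proof. by move=> t0; apply: continuous_bounded_measurable; [exact: cgu|move=> x; exact: guM]. Qed.

(** The operator S(T-s) is a contraction for the supremum norm, so it preserves
    the uniform approximation by Riemann sums, and by the semigroup law it turns
    S(s-q) into S(T-q): the summands no longer depend on s. *)
Lemma mild_riemann (s T eps : R) : 0 <= s -> s <= T -> 0 < eps ->
  exists2 delta : R, 0 < delta &
    forall (n : nat) (sg tau : nat -> R), tagged_partition 0 s delta n sg tau ->
      forall x, `|evolve (T - s) (u s) x - evolve T u0 x -
        \sum_(k < n) (sg k.+1 - sg k) * evolve (T - tau k) (g \o u (tau k)) x| <= eps.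
Proof.
move=> s0 sT eps0; have [delta delta0 Hd] := mild s0 eps0.
exists delta; first exact: delta0.
move=> n sg tau part x; have {Hd} E_eps := Hd n sg tau part.
have tau_in i (ni : (i < n)%N) := tagged_partition_bounds part ni.
pose h i := evolve (s - tau i) (g \o u (tau i)).
have hb i : (i < n)%N -> bounded_measurable M (h i).
  by move=> /tau_in /andP[t0 _]; apply/evolve_bounded_measurable/gu_mb.
have Ts : 0 <= T - s by rewrite subr_ge0.
pose c i := sg i.+1 - sg i.
have [[M' sum_mb] sumE] := evolve_sum P alpha (T - s) c x hb.
pose E z := u s z - evolve s u0 z - \sum_(i < n) c i * h i z.
have hu0_mb := evolve_bounded_measurable P alpha s u0_mb.
have E_mb : bounded_measurable eps E.
  split; last by move=> z; exact: E_eps.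
  apply: measurable_funB; last exact: sum_mb.1.
  by apply: measurable_funB; [exact: (u_mb s0).1|exact: hu0_mb.1].
have uE : u s = (fun z => (evolve s u0 z + \sum_(i < n) c i * h i z) + E z).
  by apply/funext => z; rewrite /E; ring.
rewrite {1}uE (evolveD _ _ _ _ (bounded_measurableD hu0_mb sum_mb) E_mb).
rewrite (evolveD _ _ _ _ hu0_mb sum_mb) sumE.
rewrite (evolve_semigroup alpha0 PAB _ s0 Ts cu0 u0b) subrK.
have -> : \sum_(i < n) c i * evolve (T - s) (h i) x =
    \sum_(i < n) (sg i.+1 - sg i) * evolve (T - tau i) (g \o u (tau i)) x.
  apply: eq_bigr => i _; have /andP[t0 ts] := tau_in i (ltn_ord i).
  have st : 0 <= s - tau i by rewrite subr_ge0.
  rewrite /h (evolve_semigroup alpha0 PAB x st Ts (cgu t0) (fun z => guM z t0)).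
  by rewrite addrA subrK.
set q := \sum_(i < n) _.
have -> : evolve T u0 x + q + evolve (T - s) E x - evolve T u0 x - q = evolve (T - s) E x by ring.
exact: (evolve_bounded_measurable P alpha (T - s) E_mb).2.
Qed.

(** Integrated form of d/ds S(T-s) u(s) = S(T-s) g(u(s)). *)
Lemma mild_increment (T x s s' C : R) : 0 <= s -> s <= s' -> s' <= T ->
  (forall q, s <= q <= s' -> evolve (T - q) (g \o u q) x <= C) ->
  evolve (T - s') (u s') x - evolve (T - s) (u s) x <= C * (s' - s).
Proof.
move=> s0 ss' s'T kC.
have shift (p q r : R) : p - q = p - r - (q - r) by ring.
rewrite (shift _ _ (evolve T u0 x)).
apply: (riemann_increment (k := fun q => evolve (T - q) (g \o u q) x)) => //.
- move=> eps eps0; have [d d0 H] := mild_riemann s0 (le_trans ss' s'T) eps0.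
  by exists d; [exact: d0|move=> n sg tau part; exact: H].
- move=> eps eps0; have [d d0 H] := mild_riemann (le_trans s0 ss') s'T eps0.
  by exists d; [exact: d0|move=> n sg tau part; exact: H].
Qed.

End mild.

(** * Finite speed of the front *)

(* Unfolding [evolve] makes the comparison of terms at different times very
   slow; below, it is only used through the lemmas above. *)
#[local] Opaque evolve.

Section front.
Context (R : realType) (P : probability (measurableTypeR R) R).
Variables (alpha : R) (A B : R -> R).
Hypothesis alpha0 : 0 < alpha.
Hypothesis PAB : stable_law P alpha A B.
Local Notation evolve := (evolve P alpha).
Variables (g u0 : R -> R) (u : R -> R -> R) (M gam th : R).
Hypotheses (M0 : 0 < M) (gam0 : 0 < gam) (th0 : 0 < th).
Hypothesis cu : forall t : R, 0 <= t -> continuous (u t).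
Hypothesis u01 : forall t x : R, 0 <= t -> 0 <= u t x <= 1.
Hypothesis cu0 : continuous u0.
Hypothesis u001 : forall x, 0 <= u0 x <= 1.
Hypothesis u0_supp : forall x, x < 0 -> u0 x = 0.
Hypothesis cgu : forall t : R, 0 <= t -> continuous (g \o u t).
Hypothesis gM : forall v : R, 0 <= v <= 1 -> `|g v| <= M.
Hypothesis g_le : forall v : R, 0 <= v <= 1 -> g v <= - gam * v + M.
Hypothesis g_damped : forall v : R, 0 <= v <= th -> g v <= - gam * v.
Hypothesis mild : forall t eps : R, 0 <= t -> 0 < eps ->
  exists2 delta : R, 0 < delta &
    forall (n : nat) (s tau : nat -> R), tagged_partition 0 t delta n s tau ->
      forall x, `|u t x - evolve t u0 x -
        \sum_(k < n) (s k.+1 - s k) * evolve (t - tau k) (g \o u (tau k)) x| <= eps.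

Let guM (t x : R) : 0 <= t -> `|g (u t x)| <= M.
Proof. by move=> t0; apply/gM/u01. Qed.

Let u_mb t : 0 <= t -> bounded_measurable 1 (u t).
Proof.
move=> t0; apply: continuous_bounded_measurable; first exact: cu.
by move=> x; have /andP[? ?] := u01 x t0; rewrite ger0_norm.
Qed.

Let gu_mb t : 0 <= t -> bounded_measurable M (g \o u t).
Proof. by move=> t0; apply: continuous_bounded_measurable; [exact: cgu|move=> x; exact: guM]. Qed.

Let u0_mb : bounded_measurable 1 u0.
Proof.
apply: continuous_bounded_measurable => // x.
by have /andP[? ?] := u001 x; rewrite ger0_norm.
Qed.

Let y_incr T x s s' C : 0 <= s -> s <= s' -> s' <= T ->
  (forall q, s <= q <= s' -> evolve (T - q) (g \o u q) x <= C) ->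
  evolve (T - s') (u s') x - evolve (T - s) (u s) x <= C * (s' - s).
Proof. exact: (mild_increment alpha0 PAB cu u01 cu0 u001 cgu guM mild). Qed.

Let k_leM T x q : 0 <= q -> evolve (T - q) (g \o u q) x <= M.
Proof.
move=> q0; apply: le_trans (ler_norm _) _.
exact: (evolve_bounded_measurable P alpha (T - q) (gu_mb q0)).2.
Qed.

Let y_le1 T x q : 0 <= q -> evolve (T - q) (u q) x <= 1.
Proof.
move=> q0; apply: le_trans (ler_norm _) _.
exact: (evolve_bounded_measurable P alpha (T - q) (u_mb q0)).2.
Qed.

Let evolve_now T x : evolve (T - T) (u T) x = u T x.
Proof. by rewrite subrr; exact: evolve0. Qed.

Let u_start : u 0 = u0.
Proof.
apply/funext => x; apply/eqP; rewrite -subr_eq0 -normr_le0; apply/ler_addgt0Pr => eps eps0.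
have [d d0 H] := mild (lexx 0) eps0.
have p : tagged_partition 0 0 d 0 (fun=> 0) (fun=> 0) by split.
by have := H _ _ _ p x; rewrite big_ord0 subr0 (evolve0 _ alpha0) add0r.
Qed.

(** The solution takes its values in [0, 1], so a time 2 / (gam eta) is enough
    to fall below the level N / gam + eta from any starting value. *)
Lemma relaxation_bound (a b T x N eta : R) : 0 <= a -> a <= b -> b <= T ->
  0 <= N -> 0 < eta ->
  (forall q, a <= q <= b ->
     evolve (T - q) (g \o u q) x <= - gam * evolve (T - q) (u q) x + N) ->
  evolve (T - a) (u a) x <= N / gam + eta \/ 1 <= gam * eta / 2 * (b - a) ->
  evolve (T - b) (u b) x <= N / gam + eta.
Proof.
move=> a0 ab bT N0 eta0 kN start; rewrite leNgt; apply/negP => Lb.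
have := @relaxation_backward R (fun q => evolve (T - q) (u q) x)
  (fun q => evolve (T - q) (g \o u q) x) a b gam N eta M ab gam0 eta0 M0 _ kN _ Lb.
have ge0 : 0 <= gam * eta / 2 * (b - a).
  by rewrite mulr_ge0 ?subr_ge0// divr_ge0// mulr_ge0// ltW.
have N0' : 0 <= N / gam by rewrite divr_ge0// ltW.
have H1 (s s' C : R) : a <= s -> s <= s' -> s' <= b ->
    (forall q : R, s <= q <= s' -> evolve (T - q) (g \o u q) x <= C) ->
    evolve (T - s') (u s') x - evolve (T - s) (u s) x <= C * (s' - s).
  by move=> sa ss' s'b; apply: y_incr => //; [exact: le_trans sa|exact: le_trans bT].
have H2 q : a <= q <= b -> evolve (T - q) (g \o u q) x <= M.
  by move=> /andP[aq _]; apply/k_leM/(le_trans a0).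
move=> /(_ H1 H2) H.
move: H (y_le1 T x a0) start Lb ge0 N0'; rewrite /=.
move: (evolve (T - a) _ _) (evolve (T - b) _ _) (N / gam) (gam * eta / 2 * _) => ya yb.
by move=> n r H ya1 [?|?] ? ? ?; lra.
Qed.

Section tail.
Variable C : R.
Hypothesis C0 : 0 < C.
Hypothesis tail : forall t (h : R -> R) (x b D : R), 0 <= t -> 0 < D -> x <= b - D ->
  bounded_measurable 1 h -> (forall z, 0 <= h z) -> (forall z, z <= b -> h z = 0) ->
  evolve t h x <= C * t / D `^ alpha.

(** Where u is at most th the reaction is bounded by - gam u; the excess M is
    paid only beyond b, and is seen from x through the tail of the law. *)
Lemma reaction_bound (T x q b D : R) : 0 <= q -> q <= T -> 0 < D -> x <= b - D ->
  (forall z, z <= b -> u q z <= th) ->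
  evolve (T - q) (g \o u q) x <=
    - gam * evolve (T - q) (u q) x + M * (C * (T - q) / D `^ alpha).
Proof.
move=> q0 qT D0 xb small.
pose h z : R := \1_(`]b, +oo[%classic : set R) z.
have h_mb : bounded_measurable 1 h.
  split; first exact: measurable_indic.
  by move=> z; rewrite /h indicE ger0_norm// lern1 leq_b1.
have hE z : h z = (b < z)%R%:R.
  by rewrite /h indicE; congr (nat_of_bool _)%:R; apply/idP/idP;
    rewrite inE/= in_itv/= andbT.
have Tq : 0 <= T - q by rewrite subr_ge0.
have le z : (g \o u q) z <= - gam * u q z + M * h z.
  rewrite hE/=; have [zb|bz] := leP z b.
    rewrite mulr0 addr0; apply: g_damped; rewrite small// andbT.
    by have /andP[] := u01 z q0.
  by rewrite mulr1; exact/g_le/u01.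
apply: (@le_trans _ _ (evolve (T - q) (fun z => - gam * u q z + M * h z) x)).
  exact: (evolve_le _ _ _ _ (gu_mb q0)
    (bounded_measurableD (bounded_measurableZ (- gam) (u_mb q0)) (bounded_measurableZ M h_mb)) le).
rewrite (evolveD _ _ _ _ (bounded_measurableZ (- gam) (u_mb q0)) (bounded_measurableZ M h_mb)).
rewrite (evolveZ _ _ _ _ _ (u_mb q0)) (evolveZ _ _ _ _ _ h_mb) lerD2l ler_pM2l//.
apply: (tail Tq D0 xb h_mb) => z; first by rewrite hE ler0n.
by rewrite hE leNgt => /negbTE ->.
Qed.

(** Induction over time steps of length h.  At time T, the bound is known up to
    T - h; the relaxation is run on [T - R0, T - h], or on [0, T - h] when T is
    smaller than R0, in which case the initial datum is still small at x. *)
Lemma front_confined : exists c K : R, [/\ 0 < c, 0 < K &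
  forall T x : R, 0 <= T -> x <= - (c * T) - K -> u T x <= th].
Proof.
pose h := th / (4 * M); pose eta := th / 4.
have h0 : 0 < h by rewrite divr_gt0// mulr_gt0.
have eta0 : 0 < eta by rewrite divr_gt0.
pose R0 := h + 2 / (gam * eta).
have R00 : 0 < 2 / (gam * eta) by rewrite divr_gt0// mulr_gt0.
have R0h : h <= R0 by rewrite lerDl ltW.
(* The threshold m for the jump probabilities is such that both the initial
   value and the relaxation level M m / gam are at most th / 4. *)
pose m := Num.min (th / 4) (th * gam / (4 * M)).
have m0 : 0 < m by rewrite lt_min divr_gt0//= divr_gt0// mulr_gt0.
(* D is the depth at which the tail C R0 / D^alpha equals m; the speed c is
   chosen so that the front moves by D during one step. *)
pose Q := C * R0 / m.
have Q0 : 0 < Q by rewrite divr_gt0// mulr_gt0// (lt_le_trans h0).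
pose D := Q `^ alpha^-1.
have D0 : 0 < D by exact: powR_gt0.
have DQ : D `^ alpha = Q by rewrite -powRrM mulVf ?gt_eqF// powRr1// ltW.
have tail_m r : r <= R0 -> C * r / D `^ alpha <= m.
  move=> rR; rewrite DQ ler_pdivrMr// /Q mulrCA divff ?gt_eqF// mulr1.
  by rewrite ler_pM2l.
have m1 : m <= th / 4 by rewrite ge_min lexx.
have m2 : M * m / gam <= th / 4.
  have : m <= th * gam / (4 * M) by rewrite ge_min lexx orbT.
  rewrite ler_pdivlMr ?mulr_gt0// => H; rewrite ler_pdivrMr//.
  by lra.
have Mh : M * h = th / 4 by rewrite /h; field; rewrite gt_eqF.
pose c := D / h.
have c0 : 0 < c by rewrite divr_gt0.
have ch : c * h = D by rewrite /c divfK// gt_eqF.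
exists c, (2 * D); split=> //; first by rewrite mulr_gt0.
suff main n : forall T x : R, 0 <= T -> T <= n%:R * h -> x <= - (c * T) - 2 * D -> u T x <= th.
  move=> T x T0 xT; apply: (main (Num.bound (T / h))) => //.
  by rewrite -ler_pdivrMr// ltW// archi_boundP// divr_ge0// ltW.
have cT T : 0 <= T -> 0 <= c * T by move=> T0; rewrite mulr_ge0// ltW.
have start (T x : R) : 0 <= T -> T <= R0 -> x <= - (c * T) - 2 * D ->
    evolve (T - 0) (u 0) x <= m.
  move=> T0 TR xT; rewrite subr0 u_start.
  apply: le_trans (tail_m _ TR); apply: (tail (b := - D)) => //.
  - by have := cT _ T0; lra.
  - by move=> z; have /andP[] := u001 z.
  - by move=> z zD; apply: u0_supp; lra.
elim: n => [|n IH] T x T0 Tn xT.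
  have TE : T = 0 by apply/eqP; rewrite eq_le T0 andbT (le_trans Tn)// mul0r.
  have := start _ _ T0 _ xT; rewrite TE subrr (evolve0 _ alpha0) => H.
  by have := H (le_trans (ltW h0) R0h); lra.
have last (s : R) : 0 <= s -> s <= T -> T - s <= h ->
    u T x <= evolve (T - s) (u s) x + th / 4.
  move=> s0 sT Ts.
  have kM q : s <= q <= T -> evolve (T - q) (g \o u q) x <= M.
    by move=> /andP[sq _]; apply/k_leM/(le_trans s0).
  have := y_incr s0 sT (lexx T) kM; rewrite evolve_now.
  have : M * (T - s) <= M * h by rewrite ler_pM2l.
  by move: (evolve _ _ _) => y; lra.
have [Th|Th] := leP T h.
  have := last 0 (lexx 0) T0; rewrite {1}subr0 => /(_ Th).
  by have := start T x T0 (le_trans Th R0h) xT; lra.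
have Th0 : 0 <= T - h by rewrite subr_ge0 ltW.
suff : evolve (T - (T - h)) (u (T - h)) x <= M * m / gam + eta.
  have := last (T - h) Th0; rewrite gerBl (ltW h0) opprB addrC subrK lexx.
  by move=> /(_ isT isT); rewrite /eta; lra.
pose a := Num.max 0 (T - R0).
have a0 : 0 <= a by rewrite le_max lexx.
have aT : T - R0 <= a by rewrite le_max lexx orbT.
apply: (@relaxation_bound a (T - h)) => //.
- by rewrite ge_max Th0 lerD2l lerN2.
- by rewrite gerBl ltW.
- by rewrite mulr_ge0// ltW.
- move=> q /andP[aq qT].
  have q0 := le_trans a0 aq.
  have qTT : q <= T by rewrite (le_trans qT)// gerBl ltW.
  have xq : x <= (- (c * q) - 2 * D) - D.
    have : c * h <= c * (T - q) by rewrite ler_pM2l//; lra.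
    by rewrite ch; lra.
  apply: le_trans (reaction_bound q0 qTT D0 xq _) _.
    move=> z zq; apply: (IH q z q0) => //.
    by apply: le_trans qT _; move: Tn; rewrite -natr1; lra.
  rewrite lerD2l ler_pM2l//; apply: tail_m.
  by lra.
- have [TR|TR] := leP T R0.
    left; have -> : a = 0 by apply/max_idPl; rewrite subr_le0.
    have := start T x T0 TR xT.
    have : 0 <= M * m / gam by rewrite divr_ge0 ?mulr_ge0// ltW.
    by rewrite /eta; lra.
  right; have -> : a = T - R0 by apply/max_idPr; rewrite subr_ge0 ltW.
  have -> : T - h - (T - R0) = 2 / (gam * eta) by rewrite /R0; ring.
  have -> : gam * eta / 2 * (2 / (gam * eta)) = 1 by field; rewrite !gt_eqF.
  by [].
Qed.

(** At time T and to the left of - 2 c T, the distance to the confined front is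
    at least c T - K throughout [T - R1, T], so the jump term tends to zero while
    R1 is fixed by the precision eps alone. *)
Lemma front_vanishing : exists2 c : R, 0 < c &
  forall eps, 0 < eps -> exists T0 : R, forall T x, T0 <= T ->
    x <= - (c * T) -> u T x <= eps.
Proof.
have [c [K [c0 K0 conf]]] := front_confined.
exists (2 * c) => [|eps eps0]; first by rewrite mulr_gt0.
pose eta := eps / 2; have eta0 : 0 < eta by rewrite divr_gt0.
pose R1 := 2 / (gam * eta).
have R10 : 0 < R1 by rewrite divr_gt0// mulr_gt0.
pose Q := M * (C * R1) / (gam * eta).
have Q0 : 0 < Q.
  by apply: divr_gt0; [apply: mulr_gt0 => //; exact: mulr_gt0|exact: mulr_gt0].
pose D := Q `^ alpha^-1.
have D0 : 0 < D by exact: powR_gt0.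
have DQ : D `^ alpha = Q by rewrite -powRrM mulVf ?gt_eqF// powRr1// ltW.
exists (Num.max R1 ((D + K) / c)) => T x; rewrite ge_max => /andP[TR TD] xT.
have T0 : 0 <= T by rewrite (le_trans (ltW R10)).
have {}TD : D + K <= c * T by rewrite mulrC -ler_pdivrMr.
pose N := M * (C * R1 / D `^ alpha).
have NE : N / gam = eta.
  rewrite /N DQ /Q; field.
  by rewrite !gt_eqF.
have := @relaxation_bound (T - R1) T T x N eta.
rewrite evolve_now NE => H.
have -> : eps = eta + eta by rewrite /eta; lra.
apply: H => //.
- by rewrite subr_ge0.
- by rewrite gerBl ltW.
- rewrite /N DQ; apply: mulr_ge0; first exact: ltW.
  by rewrite divr_ge0 ?(ltW Q0)// mulr_ge0// ltW.
- move=> q /andP[aq qT].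
  have q0 : 0 <= q by rewrite (le_trans _ aq)// subr_ge0.
  have cq : c * q <= c * T by rewrite ler_pM2l.
  have xq : x <= (- (c * q) - K) - D by lra.
  apply: le_trans (reaction_bound q0 qT D0 xq _) _.
    by move=> z; exact: conf.
  rewrite lerD2l /N ler_pM2l// ler_pM2r ?invr_gt0 ?powR_gt0// ler_pM2l//.
  by lra.
- right; rewrite opprB addrC subrK /R1.
  have -> : gam * eta / 2 * (2 / (gam * eta)) = 1 by field; rewrite !gt_eqF.
  by [].
Qed.

End tail.

End front.

(** * The reaction term *)

Section reaction_term.
Context (R : realType).

Lemma quotient_near (D : set R) (g : R -> R) (x l : R) (e : R) :
  quotient_at D g x --> l -> 0 < e -> exists2 d : R, 0 < d &
    forall y, D y -> y != x -> `|y - x| < d -> `|l - (g y - g x) / (y - x)| < e.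
Proof.
move=> gl e0; move/cvgrPdist_lt: gl => /(_ e e0).
rewrite near_withinE; move=> /nbhs_ballP[d /= d0 H].
exists d => // y Dy yx yd; apply: (H y) => //.
by rewrite /ball/= distrC.
Qed.

(** Differentiability relative to D gives a Lipschitz estimate at the point,
    along D; for g on [0, 1] this is one-sided at the endpoints. *)
Lemma quotient_lipschitz (D : set R) (g : R -> R) (x : R) :
  cvg (quotient_at D g x) -> exists (d L : R), [/\ 0 < d, 0 < L &
    forall y, D y -> `|y - x| < d -> `|g y - g x| <= L * `|y - x|].
Proof.
move=> /quotient_near /(_ ltr01)[d d0 H]; set l := lim _ in H.
exists d, (`|l| + 1); split; [by []|by rewrite ltr_wpDl|move=> y Dy yd].
have [->|yx] := eqVneq y x; first by rewrite !subrr normr0 mulr0.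
have {}H := H y Dy yx yd.
have yx0 : 0 < `|y - x| by rewrite normr_gt0 subr_eq0.
rewrite -ler_pdivrMr// -normf_div.
have -> : (g y - g x) / (y - x) = l - (l - (g y - g x) / (y - x)) by rewrite subKr.
by rewrite (le_trans (ler_normB _ _))// lerD2l ltW.
Qed.

(** Retraction of the line onto [0, 1]; composing g with it gives a continuous
    function on the line that agrees with g on the range of the solution. *)
Definition clamp (v : R) : R := Num.max 0 (Num.min 1 v).

Lemma clamp_in v : clamp v \in `[0, 1].
Proof. by rewrite in_itv/= /clamp le_max lexx ge_max ler01 ge_min lexx. Qed.

Lemma clamp_id v : 0 <= v <= 1 -> clamp v = v.
Proof. by move=> /andP[v0 v1]; rewrite /clamp (min_idPr v1) (max_idPr v0). Qed.

Lemma clamp_dist v w : `|clamp v - clamp w| <= `|v - w|.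
Proof.
have le (a b : R) : a <= b -> `|clamp a - clamp b| <= `|a - b|.
  move=> ab; rewrite (distrC a) (ger0_norm (_ : 0 <= b - a)) ?subr_ge0//.
  rewrite /clamp !maxEle !minEle ler_norml.
  case: (lerP 1 a) => a1; case: (lerP 1 b) => b1; rewrite ?ler01;
    case: (lerP 0 a) => a0; case: (lerP 0 b) => b0; apply/andP; split; lra.
have [vw|/ltW wv] := leP v w; first exact: le.
by rewrite distrC (distrC v); exact: le.
Qed.

Lemma continuous_clamp (g : R -> R) :
  (forall x, x \in `[0, 1] -> cvg (quotient_at `[0, 1] g x)) ->
  continuous (g \o clamp).
Proof.
move=> gd x; apply/cvgrPdist_lt => e e0.
have [d [L [d0 L0 H]]] := quotient_lipschitz (gd _ (clamp_in x)).
apply/nbhs_ballP; exists (Num.min d (e / L)) => /=.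
  by rewrite lt_min d0 divr_gt0.
move=> y; rewrite /ball /= lt_min => /andP[yd ye].
have cyx : `|clamp y - clamp x| <= `|x - y| by rewrite (distrC x) clamp_dist.
rewrite distrC (le_lt_trans (H _ _ _))//.
- exact: clamp_in.
- exact: le_lt_trans yd.
- by rewrite mulrC -ltr_pdivlMr// (le_lt_trans cyx).
Qed.

Lemma bounded_reaction (g : R -> R) :
  (forall x, x \in `[0, 1] -> cvg (quotient_at `[0, 1] g x)) ->
  exists2 M : R, 0 < M & forall v, 0 <= v <= 1 -> `|g v| <= M.
Proof.
move=> /continuous_clamp cg.
have cn : {within `[0, 1], continuous (fun v => `|(g \o clamp) v|)}.
  apply: continuous_subspaceT => x.
  by apply: (@cvg_comp _ _ _ (g \o clamp) Num.norm _ _ _ (cg x)); exact: norm_continuous.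
have [c _ H] := EVT_max ler01 cn.
exists (`|(g \o clamp) c| + 1); first by rewrite ltr_wpDl.
move=> v v01; have := H v; rewrite in_itv/= clamp_id// => /(_ v01) gv.
by rewrite (le_trans gv)// lerDl.
Qed.

Lemma damped_near_zero (g : R -> R) :
  cvg (quotient_at `[0, 1] g 0) -> g 0 = 0 -> derive_on `[0, 1] g 0 < 0 ->
  exists gam th : R, [/\ 0 < gam, 0 < th &
    forall v, 0 <= v <= th -> g v <= - gam * v].
Proof.
rewrite /derive_on; set l := lim _ => gd g0 l0.
have gam0 : 0 < - l / 2 by rewrite divr_gt0// oppr_gt0.
have [d d0 H] := quotient_near gd gam0.
exists (- l / 2), (Num.min 1 (d / 2)); split => //.
  by rewrite lt_min ltr01 divr_gt0.
move=> v /andP[v0]; rewrite le_min => /andP[v1 vd].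
have [->|vne] := eqVneq v 0; first by rewrite g0 mulr0.
have vpos : 0 < v by rewrite lt_neqAle eq_sym vne.
have v01 : [set` `[(0 : R), 1]] v by rewrite /= in_itv/= v0.
have vd' : v < d by lra.
have := H v v01 vne; rewrite g0 !subr0 (ger0_norm v0) => /(_ vd').
rewrite ltr_norml => /andP[+ _].
rewrite -/l => H1.
have : g v / v < l / 2 by lra.
rewrite ltr_pdivrMr// => H2.
by lra.
Qed.

End reaction_term.

(** * The limit superior *)

(** The lower bound holds because arbitrarily large times are positive and the
    half-line is not empty; for negative times nothing is known about u. *)
Lemma limf_esup_sup_eq0 (R : realType) (u : R -> R -> R) (c : R) :
  (forall t x : R, 0 <= t -> 0 <= u t x) ->
  (forall eps, 0 < eps -> exists T0 : R, forall T x : R, T0 <= T ->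
    x <= - (c * T) -> u T x <= eps) ->
  limf_esup (fun t : R => ereal_sup [set (u t x)%:E | x in `]-oo, - (c * t)]])
      +oo = 0%E.
Proof.
move=> u0 small; rewrite limf_esupE; apply/eqP; rewrite eq_le; apply/andP; split.
  apply/lee_addgt0Pr => eps eps0; rewrite add0e.
  have [T0 HT] := small _ eps0.
  apply: (@le_trans _ _ (ereal_sup ((fun t : R =>
      ereal_sup [set (u t x)%:E | x in `]-oo, - (c * t)]]) @` [set t | T0 < t]))).
    apply: ereal_inf_lbound; exists [set t | T0 < t] => //.
    by exists T0; split => //; exact: num_real.
  apply: ge_ereal_sup => _ [t /= Tt <-]; apply: ge_ereal_sup => _ [x /= xt <-].
  by rewrite lee_fin; apply: HT; [exact: ltW|move: xt; rewrite in_itv].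
apply: le_ereal_inf_tmp => _ [V [b [_ Vb]] <-].
pose t := Num.max 0 (b + 1).
have t0 : 0 <= t by rewrite le_max lexx.
have Vt : V t by apply: Vb; rewrite lt_max ltrDl ltr01 orbT.
apply: (@le_trans _ _ (u t (- (c * t)))%:E); first by rewrite lee_fin u0.
apply: (@le_trans _ _ (ereal_sup [set (u t x)%:E | x in `]-oo, - (c * t)]])).
  by apply: ereal_sup_ubound; exists (- (c * t)) => //=; rewrite in_itv/=.
by apply: ereal_sup_ubound; exists t.
Qed.

Lemma mild_solution_evolve (R : realType) (alpha : R) (f g u0 : R -> R) (u : R -> R -> R)
    (P : probability (measurableTypeR R) R) :
  0 < alpha -> measurable_fun setT (f : measurableTypeR R -> R) ->
  (forall h : measurableTypeR R -> R, measurable_fun setT h ->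
    \int[P]_v h v = \int[lebesgue_measure]_v (f v * h v)) ->
  continuous u0 -> (forall t, 0 <= t -> continuous (g \o u t)) ->
  mild_solution f alpha g u0 u ->
  forall t eps : R, 0 <= t -> 0 < eps ->
  exists2 delta : R, 0 < delta &
    forall (n : nat) (s tau : nat -> R), tagged_partition 0 t delta n s tau ->
      forall x, `|u t x - evolve P alpha t u0 x -
        \sum_(k < n) (s k.+1 - s k) *
          evolve P alpha (t - tau k) (g \o u (tau k)) x| <= eps.
Proof.
move=> alpha0 mf PE cu0 cgu [_ _ mild] t eps t0 eps0.
have [I [_ HI] uI] := mild t t0.
have [d d0 H] := HI eps eps0.
exists d => [//|n s tau part x].
have mu0 : measurable_fun setT (u0 : measurableTypeR R -> R).
  exact: continuous_measurable_fun.
have sumE : \sum_(k < n) (s k.+1 - s k) *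
      semigroup f alpha (t - tau k) (g \o u (tau k)) x =
    \sum_(k < n) (s k.+1 - s k) * evolve P alpha (t - tau k) (g \o u (tau k)) x.
  apply: eq_bigr => k _; congr (_ * _).
  have /andP[tau0 taut] := tagged_partition_bounds part (ltn_ord k).
  apply: (semigroupE alpha0 mf PE); first by rewrite subr_ge0.
  by apply: continuous_measurable_fun; exact: cgu.
have := H n s tau part x; rewrite sumE uI (semigroupE alpha0 mf PE x t0 mu0) distrC.
set a := evolve P alpha t u0 x; set b := \sum_(k < n) _ => Hb.
by have -> : a + I x - a - b = I x - b by ring.
Qed.

Theorem theorem3p2 (R : realType) (alpha beta : R) (f g u0 : R -> R)
  (u : R -> R -> R)
  (halpha : 0 < alpha < 2)
  (hbeta : -1 < beta < 1)
  (hf : stable_density alpha beta f)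
  (hg : C1_on 0 1 g)
  (hg0 : g 0 = 0)
  (hg1 : g 1 = 0)
  (hu0_cont : continuous u0)
  (hu0_01 : forall x, 0 <= u0 x <= 1)
  (hu0_lim : u0 x @[x --> +oo] --> (1 : R))
  (hu0_supp : closure [set x | u0 x != 0] `<=` `[0, +oo[)
  (hu : mild_solution f alpha g u0 u)
  (hu01 : forall t x : R, 0 <= t -> 0 <= u t x <= 1)
  (hg'0 : derive_on `[0, 1] g 0 < 0) :
  exists2 c : R, 0 < c &
    limf_esup (fun t : R => ereal_sup [set (u t x)%:E | x in `]-oo, - (c * t)]])
      +oo = 0%E.
Proof.
have alpha0 : 0 < alpha by case/andP: halpha.
have gd x : x \in `[0, 1] -> cvg (quotient_at `[0, 1] g x) := hg.1 x.
have [P [A [B [PAB PE]]]] := stable_density_law alpha0 hf.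
have [M0 M00 gM0] := bounded_reaction gd.
have [|gam [th [gam0 th0 g_damped]]] := damped_near_zero _ hg0 hg'0.
  by apply: gd; rewrite in_itv/= lexx ler01.
have mf : measurable_fun setT (f : measurableTypeR R -> R) by case: hf.
have cu t : 0 <= t -> continuous (u t) by move=> t0; case: hu => /(_ t t0) [].
have cgu t : 0 <= t -> continuous (g \o u t).
  move=> t0; have -> : g \o u t = (g \o clamp (R:=R)) \o u t.
    by apply/funext => x; rewrite /= clamp_id// hu01.
  move=> x; apply: (@cvg_comp _ _ _ (u t) (g \o clamp (R:=R)) _ _ _ (cu t t0 x)).
  exact: continuous_clamp.
have mild := mild_solution_evolve alpha0 mf PE hu0_cont cgu hu.
have u0_supp x : x < 0 -> u0 x = 0.
  move=> x0; apply/eqP; apply: contraT => u0x.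
  have := hu0_supp x (@subset_closure _ _ x u0x).
  by rewrite /= in_itv/= andbT leNgt x0.
have [C C0 tail] := evolve_tail alpha0 PAB.
have M_gt0 : 0 < M0 + gam by rewrite addr_gt0.
have gM v : 0 <= v <= 1 -> `|g v| <= M0 + gam.
  by move=> /gM0 /le_trans; apply; rewrite lerDl ltW.
have g_le v : 0 <= v <= 1 -> g v <= - gam * v + (M0 + gam).
  move=> v01; have := gM0 v v01; rewrite ler_norml => /andP[_ gv].
  have : gam * v <= gam * 1 by rewrite ler_pM2l//; case/andP: v01.
  by lra.
have [c c0 small] := front_vanishing alpha0 PAB M_gt0 gam0 th0 cu hu01 hu0_cont
  hu0_01 u0_supp cgu gM g_le g_damped mild C0 tail.
exists c => //; apply: limf_esup_sup_eq0 => // t x t0.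
by have /andP[] := hu01 t x t0.
Qed.
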